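(* Let $\alpha\in\mathbb{Z}_{\ge0}$, $f=z(z+\alpha)$, $A=A(f)$, and let $\mathcal{F}$ be an autoequivalence of $\operatorname{gr}A$. Then there exist unique integers $a\in\{1,-1\}$ and $b$ such that for all $n\in\mathbb{Z}$, $\{\mathcal{F}(X\langle n\rangle),\mathcal{F}(Y\langle n\rangle)\}\cong\{X\langle an+b\rangle,Y\langle an+b\rangle\}$ (as unordered pairs of isomorphism classes), for all $\lambda\in\Bbbk\setminus\mathbb{Z}$, $\mathcal{F}(M_\lambda)\cong M_{a\lambda+b}$, and, if $\alpha>0$, $\mathcal{F}(Z\langle n\rangle)\cong Z\langle an+b\rangle$ for all $n$.
   Context: $\Bbbk$ algebraically closed of characteristic $0$; functors are $\Bbbk$-linear. $A=A(f)$ generated by $\Bbbk[z],x,y$ with $xz=(z+1)x$, $yz=(z-1)y$, $xy=f$, $yx=f(z-1)$, graded by $\deg x=1,\deg y=-1,\deg z=0$; $\operatorname{gr}A$: finitely generated graded right $A$-modules with degree-$0$ maps; $M\langle i\rangle_j=M_{j-i}$. If $\alpha=0$: $X=A/(xA+zA)$; if $\alpha>0$: $X=(A/(xA+(z+\alpha)A))\langle-\alpha\rangle$, $Z=A/(y^\alpha A+xA+zA)$; in both cases $Y=(A/(yA+(z-1)A))\langle1\rangle$ and $M_\lambda=A/(z+\lambda)A$. *)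

(* Defs.v *)
(* Graded right modules over the generalized Weyl algebra
   A(f) = k[z]<x,y> / (xz=(z+1)x, yz=(z-1)y, xy=f, yx=f(z-1)),
   deg x = 1, deg y = -1, deg z = 0. *)
From HB Require Import structures.
From mathcomp Require Import all_boot all_order all_algebra.
Set Implicit Arguments. Unset Strict Implicit. Unset Printing Implicit Defensive.
Import Order.TTheory GRing.Theory Num.Theory.
Local Open Scope ring_scope.

Section GWA.
Variable k : fieldType.

Definition pact (V : lmodType k) (zz : V -> V) (p : {poly k}) (m : V) : V :=
  \sum_(i < size p) p`_i *: iter i zz m.

(* A graded right A(f)-module: M = (+)_j M_j, with right actions
   z : M_j -> M_j, x : M_j -> M_(j+1), y : M_(j+1) -> M_j
   satisfying the defining relations of A(f) (right module: m.(ab) = (m.a).b). *)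
Record grmod (f : {poly k}) := GrMod {
  car : int -> lmodType k;
  zz : forall j, {linear car j -> car j};
  xx : forall j, {linear car j -> car (j + 1)};
  yy : forall j, {linear car (j + 1) -> car j};
  rel_xz : forall j (m : car j), zz (j + 1) (xx j m) = xx j (zz j m + m);
  rel_yz : forall j (m : car (j + 1)), zz j (yy j m) = yy j (zz (j + 1) m - m);
  rel_xy : forall j (m : car j), yy j (xx j m) = pact (zz j) f m;
  rel_yx : forall j (m : car (j + 1)),
      xx j (yy j m) = pact (zz (j + 1)) (f \Po ('X - 1)) m
}.

Variable f : {poly k}.

Record grhom (M N : grmod f) := Hom {
  hfun : forall j, {linear car M j -> car N j};
  hom_z : forall j m, hfun j (zz M j m) = zz N j (hfun j m);
  hom_x : forall j m, hfun (j + 1) (xx M j m) = xx N j (hfun j m);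
  hom_y : forall j m, hfun j (yy M j m) = yy N j (hfun (j + 1) m)
}.

Definition heq (M N : grmod f) (h h' : grhom M N) :=
  forall j m, hfun h j m = hfun h' j m.

Definition iso (M N : grmod f) :=
  exists (h : grhom M N) (h' : grhom N M),
    (forall j m, hfun h' j (hfun h j m) = m) /\
    (forall j n, hfun h j (hfun h' j n) = n).

Definition submod_closed (M : grmod f) (P : forall j, car M j -> Prop) :=
  forall j,
    P j 0 /\
    (forall (a : k) u v, P j u -> P j v -> P j (a *: u + v)) /\
    (forall m, P j m -> P j (zz M j m)) /\
    (forall m, P j m -> P (j + 1) (xx M j m)) /\
    (forall m, P (j + 1) m -> P j (yy M j m)).

Definition fingen (M : grmod f) :=
  exists (n : nat) (deg : 'I_n -> int) (g : forall i, car M (deg i)),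
    forall P, @submod_closed M P -> (forall i, P (deg i) (g i)) ->
      forall j m, P j m.

(* k-linear autoequivalence of gr A (the full subcategory of finitely
   generated graded modules); the values of Fo outside gr A are irrelevant. *)
Definition autoequiv (Fo : grmod f -> grmod f)
    (Fm : forall M N, grhom M N -> grhom (Fo M) (Fo N)) :=
  (forall M, fingen M -> fingen (Fo M)) /\
  (forall M N (h h' : grhom M N), fingen M -> fingen N ->
      heq h h' -> heq (Fm _ _ h) (Fm _ _ h')) /\
  (forall M (h : grhom M M), fingen M ->
      (forall j m, hfun h j m = m) -> forall j m, hfun (Fm _ _ h) j m = m) /\
  (forall M N P (g : grhom N P) (h : grhom M N) (gh : grhom M P),
      fingen M -> fingen N -> fingen P ->
      (forall j m, hfun gh j m = hfun g j (hfun h j m)) ->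
      forall j m, hfun (Fm _ _ gh) j m = hfun (Fm _ _ g) j (hfun (Fm _ _ h) j m)) /\
  (forall M N (h1 h2 h3 : grhom M N) (c : k), fingen M -> fingen N ->
      (forall j m, hfun h3 j m = c *: hfun h1 j m + hfun h2 j m) ->
      forall j m, hfun (Fm _ _ h3) j m =
                  c *: hfun (Fm _ _ h1) j m + hfun (Fm _ _ h2) j m) /\
  (forall M N (g : grhom (Fo M) (Fo N)), fingen M -> fingen N ->
      exists h : grhom M N, heq (Fm _ _ h) g) /\
  (forall M N (h h' : grhom M N), fingen M -> fingen N ->
      heq (Fm _ _ h) (Fm _ _ h') -> heq h h') /\
  (forall N, fingen N -> exists M, fingen M /\ iso (Fo M) N).

(* M is (isomorphic to) the cyclic module (A/I)<d>, where the right ideal I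
   is generated by elements r_1..r_s and R N v expresses "v.r_i = 0 for all i"
   for v in N_d: M is generated by e in degree d, e.r_i = 0, and e is
   universal (Hom(M, N) = {v in N_d | v.I = 0} via h |-> h(e)). *)
Definition cyclic_pres (M : grmod f) (d : int)
    (R : forall N : grmod f, car N d -> Prop) :=
  exists e : car M d,
    R M e /\
    (forall P, @submod_closed M P -> P d e -> forall j m, P j m) /\
    (forall (N : grmod f) (v : car N d), R N v ->
       exists h : grhom M N, hfun h d e = v /\
         forall h' : grhom M N, hfun h' d e = v -> heq h h').

Definition castc (M : grmod f) (i j : int) (e : i = j) (v : car M i) : car M j :=
  ecast l (car M l) e v.

Lemma ypow_eq1 (d : int) (n : nat) : d - n%:Z = d - n%:Z - 1 + 1.
Proof. by rewrite subrK. Qed.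

Lemma ypow_eq2 (d : int) (n : nat) : d - n%:Z - 1 = d - n.+1%:Z.
Proof. by rewrite intS opprD addrA addrAC. Qed.

Lemma ypow_eq0 (d : int) : d = d - 0%:Z.
Proof. by rewrite subr0. Qed.

Fixpoint ypow (N : grmod f) (n : nat) (d : int) : car N d -> car N (d - n%:Z) :=
  match n with
  | 0 => fun v => castc (@ypow_eq0 d) v
  | n'.+1 => fun v =>
      castc (@ypow_eq2 d n')
        (yy N (d - n'%:Z - 1) (castc (@ypow_eq1 d n') (@ypow N n' d v)))
  end.

End GWA.

Section Objects.
Variable k : fieldType.
Variable alpha : nat.

Definition fz : {poly k} := 'X * ('X + (alpha%:R)%:P).

(* X<n> = (A/(xA + (z+alpha)A))<n - alpha>  (for alpha = 0: A/(xA+zA) <n>) *)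
Definition relX (n : int) (N : grmod fz) (v : car N (n - alpha%:Z)) : Prop :=
  xx N _ v = 0 /\ zz N _ v + alpha%:R *: v = 0.

(* Y<n> = (A/(yA + (z-1)A))<n+1> *)
Definition relY (n : int) (N : grmod fz) (v : car N (n + 1)) : Prop :=
  yy N n v = 0 /\ zz N _ v - v = 0.

(* Z<n> = (A/(y^alpha A + xA + zA))<n> *)
Definition relZ (n : int) (N : grmod fz) (v : car N n) : Prop :=
  ypow alpha v = 0 /\ xx N _ v = 0 /\ zz N _ v = 0.

(* M_lambda = A/(z+lambda)A *)
Definition relM (lam : k) (N : grmod fz) (v : car N 0) : Prop :=
  zz N _ v + lam *: v = 0.

End Objects.

(* Main.v *)
(** The operator T = z - j on M_j commutes with x and y, so it is an
    endomorphism of the identity functor of gr A, and on every object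
    T-equivariance reduces gr A to representations of the doubled quiver on Z
    with yx = xy = f(T + j) between degrees j and j + 1.  On X<n>, Y<n>, Z<n>
    the operator T is the scalar -n, on M_lambda it is -lambda.  A natural
    endomorphism of the identity is determined on the free modules, whose
    endomorphism ring is k[T]; hence the preimage of T under F is p(T) for one
    polynomial p, and applying this to an object sent to a free module shows
    that p has degree 1.  So F changes the T-eigenvalue by an affine map u t + w.
    For lambda not an integer M_lambda is the only simple object with
    eigenvalue -lambda, whereas X<n> and Y<n> share the eigenvalue -n, so the
    affine map preserves the integers: u = 1 or -1 and w is an integer.
    Finally Z<n> is the one of X<n>, Y<n>, Z<n> that extends both others: there
    is no nonsplit extension between X<n> and Y<n> when alpha > 0, because
    their supports are not adjacent. *)

Require Import Defs.
From HB Require Import structures.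
From Stdlib Require Import Classical.
From mathcomp Require Import all_boot all_order all_algebra.
From mathcomp Require Import zify ring.
Set Implicit Arguments. Unset Strict Implicit. Unset Printing Implicit Defensive.
Import Order.TTheory GRing.Theory Num.Theory.
Local Open Scope ring_scope.

(** * Polynomials acting through a linear operator *)

Definition mklin (k : fieldType) (U V : lmodType k) (h : U -> V) (hl : linear h) :
  {linear U -> V} := HB.pack h (GRing.isLinear.Build k U V _ h hl).

Section Pact.
Variables (k : fieldType) (V : lmodType k).

(** Padding with zero coefficients puts polynomials of different sizes over one index range, so that
    they can be compared coefficientwise. *)
Lemma pact_widen (h : V -> V) (p : {poly k}) (n : nat) (m : V) :
  (size p <= n)%N -> pact h p m = \sum_(i < n) p`_i *: iter i h m.
Proof.
move=> le_pn; rewrite /pact (big_ord_widen n (fun i => p`_i *: iter i h m)) //.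
rewrite big_mkcond; apply: eq_bigr => i _; case: ltnP => // le_pi.
by rewrite nth_default ?scale0r.
Qed.

Lemma pactC (h : V -> V) (c : k) (m : V) : pact h c%:P m = c *: m.
Proof. by rewrite (pact_widen _ _ (size_polyC_leq1 c)) big_ord1 coefC. Qed.

Lemma pactD (h : V -> V) (p q : {poly k}) (m : V) :
  pact h (p + q) m = pact h p m + pact h q m.
Proof.
rewrite (pact_widen _ _ (leq_maxl (size p) (size q))).
rewrite (pact_widen _ _ (leq_maxr (size p) (size q))).
rewrite (pact_widen _ _ (size_polyD p q)) -big_split /=.
by apply: eq_bigr => i _; rewrite coefD scalerDl.
Qed.

Lemma pactZ (h : V -> V) (c : k) (p : {poly k}) (m : V) :
  pact h (c *: p) m = c *: pact h p m.
Proof.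
rewrite (pact_widen _ _ (size_scale_leq c p)) /pact scaler_sumr.
by apply: eq_bigr => i _; rewrite coefZ scalerA.
Qed.

Lemma eq_pact (h h' : V -> V) (p : {poly k}) (m : V) :
  h =1 h' -> pact h p m = pact h' p m.
Proof. by move=> eqh; apply: eq_bigr => i _; rewrite (eq_iter eqh). Qed.

Lemma pact_eigen (h : V -> V) (c : k) (p : {poly k}) (m : V) :
  linear h -> h m = c *: m -> pact h p m = p.[c] *: m.
Proof.
move=> hl hm; rewrite horner_coef scaler_suml; apply: eq_bigr => i _.
rewrite -scalerA; congr (_ *: _); elim: (nat_of_ord i) => [|n IHn] /=.
  by rewrite scale1r.
by rewrite IHn -[h]/(mklin hl : _ -> _) linearZ /= hm scalerA exprSr.
Qed.

Variable h : {linear V -> V}.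


Lemma pactMX (p : {poly k}) (m : V) : pact h (p * 'X) m = h (pact h p m).
Proof.
have le_pX : (size (p * 'X)%R <= (size p).+1)%N.
  have [->|p0] := eqVneq p 0; first by rewrite mul0r size_poly0.
  by rewrite (size_mulX p0).
rewrite (pact_widen _ _ le_pX) big_ord_recl coefMX scale0r add0r /pact linear_sum.
by apply: eq_bigr => i _; rewrite coefMX linearZ.
Qed.

Lemma pactX (m : V) : pact h 'X m = h m.
Proof. by rewrite -['X]mul1r pactMX pactC scale1r. Qed.

Lemma pact_linear (p : {poly k}) : linear (pact h p).
Proof.
elim/poly_ind: p => [|p c IHp] a u v; first by rewrite !pactC !scale0r scaler0 addr0.
rewrite !pactD !pactMX !pactC IHp linearP !scalerDr !scalerA mulrC.
by rewrite -!addrA; congr (_ + _); rewrite addrCA.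
Qed.

Lemma pactM (p q : {poly k}) (m : V) :
  pact h (p * q) m = pact h p (pact h q m).
Proof.
elim/poly_ind: p => [|p c IHp]; first by rewrite mul0r !pactC !scale0r.
rewrite mulrDl pactD mulrAC pactMX IHp mul_polyC pactZ pactD pactMX pactC //.
Qed.

End Pact.

Lemma pact_comp (k : fieldType) (V : lmodType k) (h : {linear V -> V})
    (p q : {poly k}) (m : V) :
  pact h (p \Po q) m = pact (pact h q) p m.
Proof.
elim/poly_ind: p => [|p c IHp]; first by rewrite comp_poly0 !pactC !scale0r.
rewrite comp_polyD comp_polyM comp_polyX comp_polyC mulrC.
rewrite [LHS]pactD [RHS]pactD !pactC pactM IHp.
by congr (_ + _); exact: esym (pactMX (mklin (pact_linear h q)) p m).
Qed.


Lemma pact_intertwine (k : fieldType) (U V : lmodType k) (h : {linear U -> U})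
    (h' : {linear V -> V}) (g : {linear U -> V}) (p : {poly k}) (m : U) :
  (forall u, g (h u) = h' (g u)) -> g (pact h p m) = pact h' p (g m).
Proof.
move=> gh; elim/poly_ind: p => [|p c IHp]; first by rewrite !pactC !scale0r linear0.
by rewrite !pactD !pactMX !pactC linearD linearZ /= gh IHp.
Qed.

Lemma pact_poly (k : fieldType) (h : {poly k} -> {poly k}) (q p m : {poly k}) :
  h =1 *%R q -> pact h p m = (p \Po q) * m.
Proof.
move=> hq; rewrite comp_polyE mulr_suml; apply: eq_bigr => i _.
rewrite -scalerAl; congr (_ *: _); elim: (nat_of_ord i) => [|n IHn] /=.
  by rewrite mul1r.
by rewrite hq IHn exprS mulrA.
Qed.

(** * The central operator and translates *)

(** Induction outward from [i] in both directions, the order in which the translates of a generator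
    of degree [i] are produced. *)
Lemma int_ind_from (i : int) (P : int -> Prop) :
  P i -> (forall j, i <= j -> P j -> P (j + 1)) ->
  (forall j, j < i -> P (j + 1) -> P j) -> forall j, P j.
Proof.
move=> Pi Pup Pdn j.
have up (n : nat) : P (i + n%:Z).
  elim: n => [|n IHn]; first by rewrite addr0.
  rewrite (_ : i + n.+1%:Z = i + n%:Z + 1); last by lia.
  by apply: Pup => //; lia.
have dn (n : nat) : P (i - n%:Z).
  elim: n => [|n IHn]; first by rewrite subr0.
  apply: Pdn; first by lia.
  by rewrite (_ : i - n.+1%:Z + 1 = i - n%:Z) //; lia.
have [le_ij|lt_ji] := lerP i j.
  by rewrite (_ : j = i + `|j - i|%N%:Z) //; lia.
by rewrite (_ : j = i - `|i - j|%N%:Z) //; lia.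
Qed.

Section GradedModules.
Variables (k : fieldType) (f : {poly k}).
Implicit Types M N : grmod f.

(** On degree [j] the operator z is T + j, so this is f(z) as a polynomial in T. Both round trips
    across the edge between degrees [j] and [j + 1] act by it. *)
Definition shiftf (j : int) : {poly k} := f \Po ('X + (j%:~R)%:P).

Lemma horner_shiftf (j : int) (t : k) : (shiftf j).[t] = f.[t + j%:~R].
Proof. by rewrite horner_comp !hornerE. Qed.

Lemma shiftf_pred (j : int) :
  (f \Po ('X - 1)) \Po ('X + ((j + 1)%:~R)%:P) = shiftf j.
Proof.
rewrite -comp_polyA; congr (_ \Po _).
by rewrite comp_polyB comp_polyX comp_polyC intrD polyCD addrA addrK.
Qed.

Lemma castc_id M (i : int) (e : i = i) (v : car M i) : castc e v = v.
Proof. by rewrite (eq_irrelevance e erefl). Qed.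

Lemma castc_trans M (i j l : int) (e : i = j) (e' : j = l) (v : car M i) :
  castc e' (castc e v) = castc (etrans e e') v.
Proof. by case: _ / e'. Qed.

Lemma castc_section M (w : forall j, car M j) (i j : int) (e : i = j) :
  castc e (w i) = w j.
Proof. by case: _ / e. Qed.

(* T = z - j, which commutes with x and y. *)
Definition cen M (j : int) (m : car M j) : car M j := zz M j m - j%:~R *: m.

Lemma cen_is_linear M j : linear (@cen M j).
Proof.
move=> a u v; rewrite /cen linearP scalerDr opprD scalerBr !scalerA mulrC.
by rewrite -!addrA; congr (_ + _); rewrite addrCA.
Qed.

HB.instance Definition _ M j :=
  GRing.isLinear.Build k _ _ _ (@cen M j) (@cen_is_linear M j).

Lemma cenE M j (m : car M j) : zz M j m = cen m + j%:~R *: m.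
Proof. by rewrite subrK. Qed.

(** Passing x raises both z and the degree by 1, and the two changes cancel in z - j. *)
Lemma cen_x M j (m : car M j) : cen (xx M j m) = xx M j (cen m).
Proof.
rewrite /cen rel_xz linearD linearB [xx M j (_ *: _)]linearZ /= intrD.
by rewrite scalerDl scale1r [_ *: _ + xx M j m]addrC opprD addrA addrK.
Qed.

Lemma cen_y M j (m : car M (j + 1)) : cen (yy M j m) = yy M j (cen m).
Proof.
rewrite /cen rel_yz !linearB [yy M j (_ *: _)]linearZ /= intrD.
by rewrite scalerDl scale1r [_ *: _ + yy M j m]addrC opprD addrA.
Qed.

Lemma yx_cen M j (m : car M j) :
  yy M j (xx M j m) = pact (@cen M j) (shiftf j) m.
Proof.
rewrite rel_xy pact_comp; apply: eq_pact => u.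
by rewrite pactD pactX pactC cenE.
Qed.

Lemma xy_cen M j (m : car M (j + 1)) :
  xx M j (yy M j m) = pact (@cen M (j + 1)) (shiftf j) m.
Proof.
rewrite rel_yx -shiftf_pred [RHS]pact_comp; apply: eq_pact => u.
by rewrite pactD pactX pactC cenE.
Qed.

Lemma yx_eigen M j (t : k) (m : car M j) :
  cen m = t *: m -> yy M j (xx M j m) = f.[t + j%:~R] *: m.
Proof.
by move=> mt; rewrite yx_cen (pact_eigen _ _ mt) ?horner_shiftf //; apply: cen_is_linear.
Qed.

Lemma xy_eigen M j (t : k) (m : car M (j + 1)) :
  cen m = t *: m -> xx M j (yy M j m) = f.[t + j%:~R] *: m.
Proof.
by move=> mt; rewrite xy_cen (pact_eigen _ _ mt) ?horner_shiftf //; apply: cen_is_linear.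
Qed.

Lemma hom_cen M N (h : grhom M N) j (m : car M j) :
  hfun h j (cen m) = cen (hfun h j m).
Proof. by rewrite /cen linearB linearZ hom_z. Qed.

(* The translates of v in all degrees: v.x^(j-i) to the right of i and
   v.y^(i-j) to the left. *)
Definition is_path N (i : int) (v : car N i) (w : forall j, car N j) :=
  [/\ w i = v, forall j, i <= j -> w (j + 1) = xx N j (w j) &
      forall j, j < i -> w j = yy N j (w (j + 1))].

(** Degrees such as [i + n%:Z + 1] and [i + n.+1%:Z] are equal but not convertible. The translates
    are therefore built with casts along the naturals, [up] for powers of x and [ypow] for powers of
    y, and only then indexed by integers. *)
Lemma path_exists N (i : int) (v : car N i) : exists w, is_path v w.
Proof.
have upS n : i + n%:Z + 1 = i + n.+1%:Z by lia.
pose up := fix up n : car N (i + n%:Z) := match n with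
  | 0 => castc (esym (addr0 i)) v
  | n'.+1 => castc (upS n') (xx N _ (up n')) end.
have eU j : i <= j -> i + `|j - i|%N%:Z = j by lia.
have eD j : ~ (i <= j) -> i - `|i - j|%N%:Z = j by lia.
(* Matching on [idP] keeps the proof of [i <= j] or of its negation, which the cast needs. *)
pose w j := match @idP (i <= j) with
  | ReflectT h => castc (eU j h) (up _)
  | ReflectF h => castc (eD j h) (ypow _ v) end.
have wU n j (e : i + n%:Z = j) : w j = castc e (up n).
  rewrite /w; case: {-}_ / idP => [h|h]; last by exfalso; lia.
  move: (eU j h); rewrite (_ : `|j - i|%N = n); last by lia.
  by move=> e'; rewrite (eq_irrelevance e e').
have wD n j (e : i - n.+1%:Z = j) : w j = castc e (ypow n.+1 v).
  rewrite /w; case: {-}_ / idP => [h|h]; first by exfalso; lia.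
  move: (eD j h); rewrite (_ : `|i - j|%N = n.+1); last by lia.
  by move=> e'; rewrite (eq_irrelevance e e').
have wi : w i = v.
  by rewrite (wU 0 i (addr0 i)) /= castc_trans castc_id.
(* Extends [wD] to [n = 0], where [w] takes the branch of [up]; both branches give [v] there. *)
have wDn n j (e : i - n%:Z = j) : w j = castc e (ypow n v).
  case: n e => [|n] e; last exact: wD.
  have eij : i = j by lia.
  by case: _ / eij e => e; rewrite wi /= castc_trans castc_id.
exists w; split=> // j ij.
  have e : i + `|j - i|%N%:Z = j by lia.
  move: `|j - i|%N e => n e; case: _ / e {ij}.
  by rewrite (wU n.+1 _ (esym (upS n))) (wU n _ erefl) /= /castc; case: _ / (upS n).
have e : i - `|i - j|%N.-1%:Z = j + 1 by lia.
move: `|i - j|%N.-1 e => n e.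
have e' : i - n.+1%:Z = j by lia.
case: _ / e' e {ij} => e.
rewrite (wDn n.+1 _ erefl) (wDn n _ e) {wi wDn} /= /castc.
move: (ypow n v) (ypow_eq1 _ _) (ypow_eq2 _ _) e => u.
move: (i - n.+1%:Z) => l e1 e2 e; case: _ / e2 e => e.
by rewrite (eq_irrelevance e1 e).
Qed.

Lemma ypow_path N (d : int) (v : car N d) w (n : nat) :
  is_path v w -> ypow n v = w (d - n%:Z).
Proof.
case=> wd _ wy; elim: n => [|n IHn] /=.
  by rewrite -wd castc_section.
by rewrite IHn castc_section -wy ?castc_section //; lia.
Qed.

End GradedModules.

(** * Morphisms and simple modules *)

Section Category.
Variables (k : fieldType) (f : {poly k}).
Implicit Types L M N : grmod f.

Definition hid M : grhom M M :=
  @Defs.Hom k f M M (fun j => idfun) (fun _ _ => erefl) (fun _ _ => erefl)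
    (fun _ _ => erefl).

Definition hcomp L M N (g : grhom M N) (h : grhom L M) : grhom L N.
Proof.
by refine (@Defs.Hom k f L N (fun j => hfun g j \o hfun h j) _ _ _) => j m /=;
   rewrite ?hom_z ?hom_x ?hom_y.
Defined.

Definition hzero M N : grhom M N.
Proof.
by refine (@Defs.Hom k f M N (fun j => \0) _ _ _) => j m /=; rewrite linear0.
Defined.

Definition hcen M : grhom M M.
Proof.
refine (@Defs.Hom k f M M (fun j => @cen k f M j) _ _ _) => j m /=.
- by rewrite /cen linearB [zz M j (_ *: _)]linearZ.
- by rewrite cen_x.
- by rewrite cen_y.
Defined.

Definition hlin M N (c : k) (g h : grhom M N) : grhom M N.
Proof.
refine (@Defs.Hom k f M N
  (fun j => mklin (_ : linear (fun m => c *: hfun g j m + hfun h j m))) _ _ _).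
- by move=> j m /=; rewrite linearP !hom_z.
- by move=> j m /=; rewrite linearP !hom_x.
- by move=> j m /=; rewrite linearP !hom_y.
Unshelve.
move=> a u v; rewrite !(linearP (hfun _ _)) !scalerDr !scalerA mulrC -!addrA; congr (_ + _).
by rewrite addrCA.
Defined.

Lemma iso_sym M N : iso M N -> iso N M.
Proof. by case=> h [h' [hK h'K]]; exists h', h. Qed.

Lemma iso_trans L M N : iso L M -> iso M N -> iso L N.
Proof.
case=> h [h' [hK h'K]] [g [g' [gK g'K]]]; exists (hcomp g h), (hcomp h' g').
by split=> j m /=; rewrite ?gK ?hK ?h'K ?g'K.
Qed.

Definition injective_hom M N (h : grhom M N) :=
  forall j m, hfun h j m = 0 -> m = 0.

Lemma iso_of_bijective M N (h : grhom M N) : injective_hom h ->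
  (forall j n, exists m, hfun h j m = n) -> iso M N.
Proof.
move=> h_inj h_surj.
(* The boolean form of surjectivity lets [xchoose] define the inverse as a function. *)
have ex j n : exists m, hfun h j m == n by have [m <-] := h_surj j n; exists m.
pose g j n := xchoose (ex j n).
have gK j n : hfun h j (g j n) = n by apply/eqP/(xchooseP (ex j n)).
have hI j m m' : hfun h j m = hfun h j m' -> m = m'.
  by move=> E; apply/eqP; rewrite -subr_eq0; apply/eqP/h_inj; rewrite linearB E subrr.
have gl j : linear (g j) by move=> a u v; apply: hI; rewrite linearP !gK.
unshelve eexists; first exact: h.
unshelve eexists.
  refine (@Defs.Hom k f N M (fun j => mklin (gl j)) _ _ _) => j m; apply: hI => /=.
  - by rewrite hom_z !gK.
  - by rewrite hom_x !gK.
  - by rewrite hom_y !gK.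
by split=> j m /=; rewrite ?gK //; apply: hI; rewrite gK.
Qed.

Lemma iso_inj M N : iso M N -> exists2 h : grhom M N, injective_hom h &
  forall j n, exists m, hfun h j m = n.
Proof.
case=> h [h' [hK h'K]]; exists h => [j m h0|j n]; last by exists (hfun h' j n).
by rewrite -[m]hK h0 linear0.
Qed.

Definition nonzero M := exists j, exists m : car M j, m <> 0.

Definition cen_scalar (t : k) M := forall j (m : car M j), cen m = t *: m.

Lemma iso_nonzero M N : iso M N -> nonzero M -> nonzero N.
Proof.
case/iso_inj => h h_inj _ [j [m m0]].
by exists j, (hfun h j m) => /h_inj.
Qed.

Lemma iso_cen_scalar t M N : iso M N -> cen_scalar t M -> cen_scalar t N.
Proof.
case/iso_inj => h _ h_surj Mt j n; have [m <-] := h_surj j n.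
by rewrite -hom_cen Mt linearZ.
Qed.

Lemma iso_vanish M N j : iso M N -> (forall m : car M j, m = 0) ->
  forall n : car N j, n = 0.
Proof.
by case/iso_inj => h _ h_surj M0 n; have [m <-] := h_surj j n; rewrite [m]M0 linear0.
Qed.

Lemma cen_scalar_inj t t' M :
  nonzero M -> cen_scalar t M -> cen_scalar t' M -> t = t'.
Proof.
case=> j [m m0] Mt Mt'; apply/eqP; rewrite -subr_eq0; apply/eqP.
have [//|d0] := eqVneq (t - t') 0; case: m0.
have : (t - t') *: m = 0 by rewrite scalerBl -Mt -Mt' subrr.
by move/eqP; rewrite scaler_eq0 (negPf d0) => /eqP.
Qed.

Definition simple M := nonzero M /\ forall P, @Defs.submod_closed k f M P ->
  forall j v, v <> 0 -> P j v -> forall i m, P i m.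

Lemma submod_ker M N (h : grhom M N) :
  Defs.submod_closed (fun j m => hfun h j m = 0).
Proof.
move=> j; split; first exact: linear0.
split=> [a u v hu hv|]; first by rewrite linearP hu hv scaler0 addr0.
by split=> [m|]; [|split=> m]; rewrite ?hom_z ?hom_x ?hom_y => ->; rewrite linear0.
Qed.

Lemma submod_im M N (h : grhom M N) :
  Defs.submod_closed (fun j n => exists m, hfun h j m = n).
Proof.
move=> j; split; first by exists 0; rewrite linear0.
split=> [a _ _ [u <-] [v <-]|]; first by exists (a *: u + v); rewrite linearP.
by split=> [_ [m <-]|]; [|split=> _ [m <-]];
  rewrite -?hom_z -?hom_x -?hom_y; eexists.
Qed.

Lemma submod_eq M N (h h' : grhom M N) :
  Defs.submod_closed (fun j m => hfun h j m = hfun h' j m).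
Proof.
move=> j; split; first by rewrite !linear0.
split=> [a u v hu hv|]; first by rewrite !linearP hu hv.
by split=> [m|]; [|split=> m]; rewrite ?hom_z ?hom_x ?hom_y => ->.
Qed.

Lemma simple_inj M N (h : grhom M N) j (m : car M j) :
  simple M -> hfun h j m <> 0 -> injective_hom h.
Proof.
case=> _ Msim hm0 i n hn; have [//|/eqP n0] := eqVneq n 0.
by case: hm0; apply: (Msim _ (submod_ker h) _ _ n0 hn).
Qed.

Lemma simple_surj M N (h : grhom M N) j (m : car M j) :
  simple N -> hfun h j m <> 0 -> forall i n, exists m', hfun h i m' = n.
Proof.
by case=> _ Nsim hm0; apply: (Nsim _ (submod_im h) _ _ hm0); exists m.
Qed.

Lemma simple_schur M N (h : grhom M N) j (m : car M j) :
  simple M -> simple N -> hfun h j m <> 0 -> iso M N.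
Proof.
move=> Msim Nsim hm0; apply: (iso_of_bijective (simple_inj Msim hm0)).
exact: simple_surj Nsim hm0.
Qed.

End Category.

(** * Free modules and modules with components of dimension at most one *)

Section Modules.
Variables (k : fieldType) (f : {poly k}).
Implicit Types L M N : grmod f.

(** Structure constants of x and y in the basis of translates of a generator of degree [i]: a step
    away from [i] costs 1, a step back costs f(T + j). *)
Definition xcoef (i j : int) : {poly k} := if i <= j then 1 else shiftf f j.
Definition ycoef (i j : int) : {poly k} := if i <= j then shiftf f j else 1.

Lemma xycoef i j : xcoef i j * ycoef i j = shiftf f j.
Proof. by rewrite /xcoef /ycoef; case: ifP; rewrite ?mulr1 ?mul1r. Qed.

Lemma path_submod N (i : int) (v : car N i) w (Q : forall j, car N j -> Prop) :
  is_path v w -> Defs.submod_closed Q -> Q i v -> forall j, Q j (w j).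
Proof.
case=> wi wx wy QM Qv; apply: (int_ind_from (i := i)); first by rewrite wi.
  by move=> j ij Qj; rewrite wx //; have [_ [_ [_ [Qx _]]]] := QM j; apply: Qx.
by move=> j ij Qj; rewrite wy //; have [_ [_ [_ [_ Qy]]]] := QM j; apply: Qy.
Qed.

Lemma path_x N (i : int) (v : car N i) w j : is_path v w ->
  xx N j (w j) = pact (@cen k f N (j + 1)) (xcoef i j) (w (j + 1)).
Proof.
case=> wi wx wy; rewrite /xcoef; case: lerP => [ij|ji].
  by rewrite -wx // pactC scale1r.
by rewrite wy // xy_cen.
Qed.

Lemma path_y N (i : int) (v : car N i) w j : is_path v w ->
  yy N j (w (j + 1)) = pact (@cen k f N j) (ycoef i j) (w j).
Proof.
case=> wi wx wy; rewrite /ycoef; case: lerP => [ij|ji].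
  by rewrite wx // yx_cen.
by rewrite -wy // pactC scale1r.
Qed.

Lemma submod_cen M (Q : forall j, car M j -> Prop) :
  Defs.submod_closed Q -> forall j m, Q j m -> Q j (cen m).
Proof.
move=> QM j m Qm; have [_ [Qlin [Qz _]]] := QM j.
by rewrite /cen addrC -scaleNr; apply: Qlin => //; apply: Qz.
Qed.

Lemma submodZ M (Q : forall j, car M j -> Prop) :
  Defs.submod_closed Q -> forall j c m, Q j m -> Q j (c *: m).
Proof.
move=> QM j c m Qm; have [Q0 [Qlin _]] := QM j.
by rewrite -[_ *: _]addr0; apply: Qlin.
Qed.

Lemma pmul_is_linear (q : {poly k}) : linear ( *%R q).
Proof. by move=> a u v; rewrite mulrDr scalerAr. Qed.

Definition pmul (q : {poly k}) : {linear {poly k} -> {poly k}} :=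
  mklin (pmul_is_linear q).

(* The shift A<i>: in each degree a copy of k[T], with basis the translates of
   the generator in degree i. *)
Definition free_mod (i : int) : grmod f.
Proof.
refine (@GrMod k f (fun _ => {poly k}) (fun j => pmul ('X + (j%:~R)%:P))
  (fun j => pmul (xcoef i j)) (fun j => pmul (ycoef i j)) _ _ _ _) => j m /=.
- by rewrite intrD polyCD; ring.
- by rewrite intrD polyCD; ring.
- by rewrite (pact_poly (q := 'X + (j%:~R)%:P)) // -/(shiftf f j) -(xycoef i); ring.
- by rewrite (pact_poly (q := 'X + ((j + 1)%:~R)%:P)) // shiftf_pred -(xycoef i) mulrA.
Defined.

Lemma free_cen i j (m : car (free_mod i) j) : cen m = 'X * (m : {poly k}).
Proof. by rewrite /cen /= mulrDl mul_polyC addrK. Qed.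

Lemma free_path i : @is_path k f (free_mod i) i 1 (fun _ => 1).
Proof.
split=> // j ij /=; first by rewrite /xcoef ij mulr1.
by rewrite /ycoef leNgt ij mulr1.
Qed.

Lemma free_generated i (Q : forall j, car (free_mod i) j -> Prop) :
  Defs.submod_closed Q -> Q i 1 -> forall j m, Q j m.
Proof.
move=> QM Q1 j; have Qj := path_submod (free_path i) QM Q1 j.
elim/poly_ind => [|p c Qp]; first by have [] := QM j.
have [_ [Qlin _]] := QM j.
rewrite addrC -[c%:P]mulr1 mul_polyC mulrC -(@free_cen i j).
by apply: Qlin => //; apply: submod_cen.
Qed.

Lemma free_fingen i : fingen (free_mod i).
Proof.
exists 1%N, (fun _ => i), (fun _ => 1) => Q QM Q1.
exact: free_generated QM (Q1 ord0).
Qed.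

(** The polynomial p in degree [j] goes to p(T) applied to the translate of [v] in that degree;
    [path_x] and [path_y] show that the structure constants agree. *)
Lemma free_hom i N (v : car N i) : exists h : grhom (free_mod i) N, hfun h i 1 = v.
Proof.
have [w vw] := path_exists v.
have hl j : linear (fun p : {poly k} => pact (@cen k f N j) p (w j)).
  by move=> a p q; rewrite pactD pactZ.
unshelve eexists.
  refine (@Defs.Hom k f (free_mod i) N (fun j => mklin (hl j)) _ _ _) => j m /=.
  - by rewrite pactM pactD pactX pactC cenE.
  - rewrite mulrC pactM -(path_x _ vw).
    by apply: esym; apply: pact_intertwine => u; rewrite -cen_x.
  - rewrite mulrC pactM -(path_y _ vw).
    by apply: esym; apply: pact_intertwine => u; rewrite -cen_y.
by rewrite /= pactC scale1r; case: vw.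
Qed.

(** Rows of length [b] form a space of dimension 1 or 0 uniformly in the boolean [b]; the sum of the
    entries is the coordinate, and is 0 in the zero space. *)
Definition rcoef (b : bool) (m : 'rV[k]_b) : k := \sum_l m 0 l.

Lemma rcoef_is_linear (b : bool) : linear (@rcoef b : _ -> k^o).
Proof.
move=> a u v; rewrite /rcoef scaler_sumr -big_split.
by apply: eq_bigr => l _; rewrite !mxE.
Qed.

HB.instance Definition _ b :=
  GRing.isLinear.Build k _ k^o _ (@rcoef b) (@rcoef_is_linear b).

Lemma rcoef_const (b : bool) (c : k) : rcoef (const_mx c : 'rV_b) = c *+ b.
Proof. by rewrite /rcoef (eq_bigr (fun=> c)) ?sumr_const ?card_ord // => l _; rewrite mxE. Qed.

Lemma const_rcoef (b : bool) (m : 'rV[k]_b) : const_mx (rcoef m) = m.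
Proof.
apply/rowP => l; rewrite mxE /rcoef; case: b m l => m l; last by case: l.
by rewrite big_ord1 (ord1 l).
Qed.

Lemma rcoef_false (b : bool) (m : 'rV[k]_b) : b = false -> rcoef m = 0.
Proof. by move: m => /[swap] -> m; rewrite -(const_rcoef m) rcoef_const. Qed.

(** * Modules with components of dimension at most one and T acting as a scalar *)

Section Thin.
Variables (t : k) (i : int) (d : int -> bool).
(** At a boundary edge of the support the round trip passes through a zero space, so f(t + j) has to
    vanish. *)
Hypothesis d_edge : forall j, d j != d (j + 1) -> f.[t + j%:~R] = 0.

Definition thin_mul (a b : bool) (c : k) (m : 'rV[k]_a) : 'rV[k]_b :=
  const_mx (c * rcoef m).

Lemma thin_mul_is_linear (a b : bool) c : linear (@thin_mul a b c).
Proof.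
move=> e u v; apply/rowP => l; rewrite !mxE linearP mulrDr /=.
by rewrite /GRing.scale /= mulrCA.
Qed.

(** The composite passes through the space of dimension [b]. If that is zero, either [s] is zero or
    the source is zero as well. *)
Lemma thin_mulK (a b : bool) (c e s : k) (m : 'rV[k]_a) :
  c * e = s -> (a != b -> s = 0) -> thin_mul a e (thin_mul b c m) = s *: m.
Proof.
move=> <- ab; rewrite /thin_mul rcoef_const -{2}(const_rcoef m).
apply/rowP => l; rewrite !mxE; case: b ab => ab; first by rewrite mulr1n; ring.
by case: a m l ab => m l ab; [rewrite ab // mulr0n mulr0 mul0r | case: l].
Qed.

Lemma scaler_is_linear (V : lmodType k) (c : k) : linear (fun m : V => c *: m).
Proof. by move=> e u v; rewrite scalerDr !scalerA mulrC. Qed.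

(* The component of degree j is k if [d j] holds and 0 otherwise, with T = t and
   structure constants normalised as in [free_mod i]. *)
Definition thin_mod : grmod f.
Proof.
refine (@GrMod k f (fun j => 'rV[k]_(d j)) (fun j => mklin (@scaler_is_linear _ (t + j%:~R)))
  (fun j => mklin (@thin_mul_is_linear (d j) (d (j + 1)) (xcoef i j).[t]))
  (fun j => mklin (@thin_mul_is_linear (d (j + 1)) (d j) (ycoef i j).[t])) _ _ _ _) => j m /=.
- apply/rowP => l; rewrite !mxE linearD linearZ /= intrD /GRing.scale /=; ring.
- apply/rowP => l; rewrite !mxE linearB linearZ /= intrD /GRing.scale /=; ring.
- rewrite (pact_eigen (c := t + j%:~R)) //; last exact: scaler_is_linear.
  rewrite /mklin; apply: (thin_mulK _ _ (d_edge (j := j))).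
  by rewrite -hornerM xycoef horner_shiftf.
- rewrite (pact_eigen (c := t + (j + 1)%:~R)) //; last exact: scaler_is_linear.
  have -> : (f \Po ('X - 1)).[t + (j + 1)%:~R] = f.[t + j%:~R].
    by rewrite horner_comp !hornerE intrD addrA addrK.
  rewrite /mklin; apply: thin_mulK => [|dj]; last by rewrite d_edge // eq_sym.
  by rewrite mulrC -hornerM xycoef horner_shiftf.
Defined.

Lemma thin_cen : cen_scalar t thin_mod.
Proof.
move=> j m; have E : zz thin_mod j m = (t + j%:~R) *: m by [].
by rewrite /cen E scalerDl addrK.
Qed.

Definition thin_one j : car thin_mod j := const_mx 1.

Lemma thin_one_neq0 j : d j -> thin_one j <> 0.
Proof.
move=> dj E; have := rcoef_const (d j) 1; rewrite -/(thin_one j) E linear0 dj.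
by move/esym/eqP; rewrite oner_eq0.
Qed.

Lemma thin_vanish j (m : car thin_mod j) : ~~ d j -> m = 0.
Proof.
move=> dj; by rewrite -(const_rcoef m) rcoef_false ?(negPf dj).
Qed.

Lemma thin_oneE j (m : car thin_mod j) :
  m = rcoef (m : 'rV_(d j)) *: thin_one j.
Proof.
rewrite /thin_one /=; by apply/rowP => l; rewrite -{1}(const_rcoef m) !mxE mulr1.
Qed.

Section ThinHom.
Variables (L N : grmod f) (g : grhom L thin_mod) (w : forall j, car N j).
Variable V : int -> bool.
Hypothesis gV : forall j l, ~~ V j -> hfun g j l = 0.
Hypothesis w_cen : forall j, cen (w j) = t *: w j.
Hypothesis w_d : forall j, ~~ d j -> w j = 0.
Hypothesis w_x : forall j, V j -> d j -> xx N j (w j) = (xcoef i j).[t] *: w (j + 1).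
Hypothesis w_y : forall j, V (j + 1) -> d (j + 1) ->
  yy N j (w (j + 1)) = (ycoef i j).[t] *: w j.

Lemma rcoefMn_w j (c : k) : (c *+ d j) *: w j = c *: w j.
Proof. by case: (boolP (d j)) => // /w_d ->; rewrite !scaler0. Qed.

Lemma rcoef_V j l (U : lmodType k) (u v : U) : (V j -> d j -> u = v) ->
  rcoef (hfun g j l) *: u = rcoef (hfun g j l) *: v.
Proof.
move=> uv; case: (boolP (V j)) => Vj; last by rewrite gV // linear0 !scale0r.
case/orP: (orbN (d j)) => dj; first by rewrite uv.
by rewrite rcoef_false ?(negPf dj) // !scale0r.
Qed.

(** Each basis vector of the thin module is replaced by [w j]. The relations on [w] are required
    only in degrees [V] where [g] can be nonzero: [V = predT] with [g] the identity maps the whole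
    thin module, and a smaller [V] treats morphisms landing in a submodule. *)
Lemma thin_hom : exists h : grhom L N,
  forall j l, hfun h j l = rcoef (hfun g j l) *: w j.
Proof.
have hl j : linear (fun l => rcoef (hfun g j l) *: w j).
  by move=> e u v; rewrite !linearP scalerDl; congr (_ + _); apply: esym; apply: scalerA.
unshelve eexists.
  refine (@Defs.Hom k f L N (fun j => mklin (hl j)) _ _ _) => j l /=.
  - rewrite hom_z /= linearZ linearZ /= cenE w_cen.
    by rewrite -scalerDl [RHS]scalerA mulrC.
  - rewrite hom_x /= /thin_mul rcoef_const rcoefMn_w [xx N j _]linearZZ mulrC -[LHS]scalerA.
    by apply: rcoef_V => Vj dj; rewrite w_x.
  - rewrite hom_y /= /thin_mul rcoef_const rcoefMn_w [yy N j _]linearZZ mulrC -[LHS]scalerA.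
    by apply: rcoef_V => Vj dj; rewrite w_y.
by [].
Qed.

End ThinHom.

Hypothesis d_right : forall j, i <= j -> d (j + 1) -> d j.
Hypothesis d_left : forall j, j < i -> d j -> d (j + 1).

Lemma thin_path : is_path (thin_one i) thin_one.
Proof.
split=> // j ij; apply/rowP => l; rewrite !mxE rcoef_const.
  by rewrite /xcoef ij d_right ?hornerC ?mulr1 //; case: (d _) l => // -[].
by rewrite /ycoef leNgt ij d_left ?hornerC ?mulr1 //=; case: (d _) l => // -[].
Qed.

Lemma thin_generated (Q : forall j, car thin_mod j -> Prop) :
  Defs.submod_closed Q -> Q i (thin_one i) -> forall j m, Q j m.
Proof.
move=> QM Q1 j m; rewrite (thin_oneE m); apply: submodZ => //.
exact: path_submod thin_path QM Q1 j.
Qed.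

Lemma thin_fingen : fingen thin_mod.
Proof.
exists 1%N, (fun _ => i), (fun _ => thin_one i) => Q QM Q1.
exact: thin_generated QM (Q1 ord0).
Qed.

End Thin.
End Modules.

(** * Action of an autoequivalence on the central operator *)

Section Autoequivalence.
Variables (k : fieldType) (f : {poly k}).
Implicit Types L M N : grmod f.

Lemma free_pact i j (q : car (free_mod f i) j) :
  pact (@cen k f (free_mod f i) j) q (1 : {poly k}) = q.
Proof.
rewrite (pact_poly (q := 'X)) ?comp_polyXr ?mulr1 // => m.
exact: free_cen.
Qed.

Lemma hom_free i N (h : grhom (free_mod f i) N) j (q : {poly k}) :
  hfun h j q = pact (@cen k f N j) q (hfun h j 1).
Proof.
rewrite -{1}(free_pact q); apply: pact_intertwine => u; exact: hom_cen.
Qed.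

Lemma hom_free0 i N (h : grhom (free_mod f i) N) :
  hfun h i 1 = 0 -> forall j q, hfun h j q = 0.
Proof. by move=> h1; apply: free_generated h1; apply: submod_ker. Qed.

Variables (Fo : grmod f -> grmod f) (Fm : forall M N, grhom M N -> grhom (Fo M) (Fo N)).
Arguments Fm {M N}.
Hypothesis hF : autoequiv (@Fm).

Lemma F_ext M N (h h' : grhom M N) : fingen M -> fingen N ->
  heq h h' -> heq (Fm h) (Fm h').
Proof. by case: hF => _ [H _]; apply: H. Qed.

Lemma F_id M : fingen M -> forall j m, hfun (Fm (hid M)) j m = m.
Proof. by case: hF => _ [_ [H _]] Mfg; apply: H. Qed.

Lemma F_comp L M N (g : grhom M N) (h : grhom L M) :
  fingen L -> fingen M -> fingen N ->
  forall j m, hfun (Fm (hcomp g h)) j m = hfun (Fm g) j (hfun (Fm h) j m).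
Proof. by case: hF => _ [_ [_ [H _]]] Lfg Mfg Nfg; apply: H. Qed.

Lemma F_lin M N (c : k) (g h : grhom M N) : fingen M -> fingen N ->
  forall j m, hfun (Fm (hlin c g h)) j m = c *: hfun (Fm g) j m + hfun (Fm h) j m.
Proof. by case: hF => _ [_ [_ [_ [H _]]]] Mfg Nfg; apply: H. Qed.

Lemma F_full M N (g : grhom (Fo M) (Fo N)) : fingen M -> fingen N ->
  exists h : grhom M N, heq (Fm h) g.
Proof. by case: hF => _ [_ [_ [_ [_ [H _]]]]]; apply: H. Qed.

Lemma F_faithful M N (h h' : grhom M N) : fingen M -> fingen N ->
  heq (Fm h) (Fm h') -> heq h h'.
Proof. by case: hF => _ [_ [_ [_ [_ [_ [H _]]]]]]; apply: H. Qed.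

Lemma F_ess N : fingen N -> exists M, fingen M /\ iso (Fo M) N.
Proof. by case: hF => _ [_ [_ [_ [_ [_ [_ H]]]]]]; apply: H. Qed.

Lemma F_zero M N : fingen M -> fingen N ->
  forall j m, hfun (Fm (hzero M N)) j m = 0.
Proof.
(* Additivity is available only in the form c h1 + h2; writing 0 as (-1) 0 + 0 gives F(0) = - F(0) +
   F(0). *)
move=> Mfg Nfg j m; have E : heq (hzero M N) (hlin (-1) (hzero M N) (hzero M N)).
  by move=> i n; rewrite /= scaler0 addr0.
by rewrite (F_ext Mfg Nfg E) F_lin // scaleN1r addNr.
Qed.

Lemma F_eq0 M N (h : grhom M N) : fingen M -> fingen N ->
  (forall j m, hfun (Fm h) j m = 0) -> forall j m, hfun h j m = 0.
Proof.
move=> Mfg Nfg h0 j m; rewrite (_ : hfun h j m = hfun (hzero M N) j m) //.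
by apply: (F_faithful Mfg Nfg) => i n; rewrite h0 F_zero.
Qed.

Lemma F_iso M N : fingen M -> fingen N -> iso M N -> iso (Fo M) (Fo N).
Proof.
move=> Mfg Nfg [h [h' [hK h'K]]]; exists (Fm h), (Fm h'); split=> j m.
  rewrite -F_comp // -[RHS]F_id //; apply: F_ext => // i n; exact: hK.
rewrite -F_comp // -[RHS]F_id //; apply: F_ext => // i n; exact: h'K.
Qed.

Lemma F_iso_inv M N : fingen M -> fingen N -> iso (Fo M) (Fo N) -> iso M N.
Proof.
move=> Mfg Nfg [g [g' [gK g'K]]].
have [h hg] := F_full g Mfg Nfg; have [h' hg'] := F_full g' Nfg Mfg.
exists h, h'; split.
  apply: (F_faithful (h := hcomp h' h) (h' := hid M)) => // j m.
  by rewrite F_comp // hg hg' gK F_id.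
apply: (F_faithful (h := hcomp h h') (h' := hid N)) => // j m.
by rewrite F_comp // hg hg' g'K F_id.
Qed.

Lemma F_nonzero M : fingen M -> nonzero M -> nonzero (Fo M).
Proof.
move=> Mfg [j [m m0]]; apply: NNPP => FM0; apply: m0.
rewrite -[LHS]/(hfun (hid M) j m); apply: (F_eq0 Mfg Mfg) => i n.
by apply: NNPP => n0; apply: FM0; eexists; eexists; exact: n0.
Qed.

Lemma F_pact M (p : {poly k}) : fingen M -> exists h : grhom M M,
  (forall j m, hfun h j m = pact (@cen k f M j) p m) /\
  (forall j n, hfun (Fm h) j n = pact (hfun (Fm (hcen M)) j) p n).
Proof.
move=> Mfg; elim/poly_ind: p => [|p c [h [hE FhE]]].
  by exists (hzero M M); split=> j m; rewrite pactC scale0r ?F_zero.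
exists (hlin c (hid M) (hcomp (hcen M) h)); split=> j m.
  by rewrite /= hE pactD pactMX pactC addrC.
by rewrite F_lin // F_id // F_comp // FhE pactD pactMX pactC addrC.
Qed.

(* The preimages under F of the central endomorphisms [cen] of the modules
   F M form an endomorphism of the identity functor. *)
Lemma theta_natural M N (g : grhom M N) (tM : grhom M M) (tN : grhom N N) :
  fingen M -> fingen N ->
  heq (Fm tM) (hcen (Fo M)) -> heq (Fm tN) (hcen (Fo N)) ->
  forall j m, hfun g j (hfun tM j m) = hfun tN j (hfun g j m).
Proof.
move=> Mfg Nfg tME tNE j m.
apply: (F_faithful (h := hcomp g tM) (h' := hcomp tN g)) => // i n.
by rewrite !F_comp // tME tNE /= hom_cen.
Qed.

(** By naturality against maps from the free module on a generator of degree [j], the preimage of T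
    acts in degree [j] through the polynomial that is the image of this generator. One free module
    then links all degrees. *)
Lemma theta_poly : exists p : {poly k}, forall M (tM : grhom M M), fingen M ->
  heq (Fm tM) (hcen (Fo M)) -> forall j m, hfun tM j m = pact (@cen k f M j) p m.
Proof.
have ffg i := free_fingen f i.
have tex i := F_full (hcen (Fo (free_mod f i))) (ffg i) (ffg i).
have local j : exists pj : {poly k}, forall M (tM : grhom M M), fingen M ->
    heq (Fm tM) (hcen (Fo M)) -> forall m, hfun tM j m = pact (@cen k f M j) pj m.
  have [tj tjE] := tex j; exists (hfun tj j 1) => M tM Mfg tME m.
  have [h <-] := free_hom m.
  by rewrite -(theta_natural h (ffg j) Mfg tjE tME) hom_free.
have [t0 t0E] := tex 0; exists (hfun t0 0 1) => M tM Mfg tME j m.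
have [pj pjE] := local j; rewrite (pjE _ _ Mfg tME).
(* On the free module of degree 0 the outward steps have coefficient 1 and commute with [t0], so the
   value at 1 is the same polynomial in every degree. *)
have <- : hfun t0 j 1 = pj by rewrite (pjE _ _ (ffg 0) t0E) free_pact.
congr (pact _ _ _); move: j {m pj pjE}.
have [_ fx fy] := free_path f 0.
apply: (int_ind_from (i := 0)) => // j j0 IHj.
  have := congr1 (hfun t0 (j + 1)) (fx j j0); rewrite hom_x IHj => ->.
  by rewrite /= /xcoef j0 mul1r.
have := congr1 (hfun t0 j) (fy j j0); rewrite hom_y IHj => ->.
by rewrite /= /ycoef leNgt j0 mul1r.
Qed.

(** Take [A] with F(A) free of rank one. There F(T) is q(T) for some q, and T is p(F(T)), so p
    composed with q is the identity polynomial and p has degree 1. *)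
Lemma F_cen_affine : exists u w : k, u != 0 /\
  forall M, fingen M -> forall j (n : car (Fo M) j),
    cen n = u *: hfun (Fm (hcen M)) j n + w *: n.
Proof.
have [p pE] := theta_poly.
have Fp M j (n : car (Fo M) j) : fingen M -> cen n = pact (hfun (Fm (hcen M)) j) p n.
  move=> Mfg; have [h [hE FhE]] := F_pact p Mfg.
  have [tM tME] := F_full (hcen (Fo M)) Mfg Mfg.
  rewrite -FhE -[LHS]/(hfun (hcen _) j n) -tME; apply: F_ext => // i m.
  by rewrite hE (pE _ _ Mfg tME).
have [A [Afg [phi [psi [phiK psiK]]]]] := F_ess (free_fingen f 0).
pose e := hfun psi 0 1.
pose S := hfun (Fm (hcen A)) 0.
pose q : {poly k} := hfun phi 0 (S e).
have gen n : exists r, n = pact (@cen k f (Fo A) 0) r e.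
  by exists (hfun phi 0 n); rewrite -hom_free phiK.
(* [e] generates degree 0 of F(A) over k[T], so its image under [S] determines [S]. *)
have Se : S e = pact (@cen k f (Fo A) 0) q e by rewrite -hom_free phiK.
have SE : S =1 pact (@cen k f (Fo A) 0) q.
  move=> n; have [r ->] := gen n.
  rewrite (pact_intertwine (h' := @cen k f (Fo A) 0)); last by move=> u; apply: hom_cen.
  by rewrite Se -!pactM mulrC.
have pq : p \Po q = 'X.
  have := Fp A 0 e Afg; rewrite (eq_pact _ _ SE) -pact_comp -(pactX (@cen k f (Fo A) 0)).
  by move=> /(congr1 (hfun phi 0)); rewrite -!hom_free !psiK.
have := size_comp_poly p q; rewrite pq size_polyX /= => /esym/eqP.
rewrite muln_eq1 => /andP[/eqP sp _].
have p1 : p`_1 != 0 by rewrite -(_ : lead_coef p = p`_1) ?lead_coef_eq0 ?lead_coefE ?sp //;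
  apply/eqP => p0; rewrite p0 size_poly0 in sp.
exists p`_1, p`_0; split=> // M Mfg j n; rewrite Fp //.
rewrite (@pact_widen _ _ _ _ 2); last by case: (size p) sp => [|[|[]]].
by rewrite !big_ord_recl big_ord0 /= addr0 addrC.
Qed.


Section Affine.
Variables u w : k.
Hypothesis u0 : u != 0.
Hypothesis F_cen : forall M, fingen M -> forall j (n : car (Fo M) j),
  cen n = u *: hfun (Fm (hcen M)) j n + w *: n.

Lemma F_cen_scalar M t :
  fingen M -> cen_scalar t M -> cen_scalar (u * t + w) (Fo M).
Proof.
move=> Mfg Mt j n; rewrite F_cen // scalerDl -scalerA; congr (_ *: _ + _).
have E : heq (hcen M) (hlin t (hid M) (hzero M M)).
  by move=> i m; rewrite /= addr0 Mt.
by rewrite (F_ext Mfg Mfg E) F_lin // F_id // F_zero // addr0.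
Qed.

Lemma F_cen_scalar_inv M t :
  fingen M -> cen_scalar (u * t + w) (Fo M) -> cen_scalar t M.
Proof.
move=> Mfg FMt j m; rewrite -[RHS]addr0 -[LHS]/(hfun (hcen M) j m).
rewrite -[RHS]/(hfun (hlin t (hid M) (hzero M M)) j m).
apply: (F_faithful Mfg Mfg) => i n; rewrite F_lin // F_id // F_zero // addr0.
apply: (scalerI u0); have := F_cen Mfg n.
by rewrite FMt scalerDl -scalerA => /addIr.
Qed.

End Affine.

(** The inclusion is pulled back to [g] from a preimage of [L] to [S]. It is nonzero because [L] is,
    hence onto because [S] is simple, and it is injective because an element of its kernel is the
    image of a generator under a map from a free module, on which faithfulness of F can be used. *)
Lemma F_simple_iso (S L : grmod f) (h : grhom L (Fo S)) :
  fingen S -> simple S -> fingen L -> nonzero L -> injective_hom h -> iso L (Fo S).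
Proof.
move=> Sfg Ssim Lfg [j [l l0]] h_inj.
have [L' [L'fg [phi [psi [phiK psiK]]]]] := F_ess Lfg.
have [g gE] := F_full (hcomp h phi) L'fg Sfg.
have phi_inj i m : hfun phi i m = 0 -> m = 0.
  by move=> m0; rewrite -[m]phiK m0 linear0.
have g_inj : injective_hom g.
  move=> i m gm; have [r rm] := free_hom m; rewrite -rm.
  have ffg := free_fingen f i; apply: (F_eq0 ffg L'fg) => i' n.
  apply/phi_inj/h_inj; rewrite -[LHS]/(hfun (hcomp h phi) i' _) -gE -F_comp //.
  have E : heq (hcomp g r) (hzero _ _); last by rewrite (F_ext ffg Sfg E) F_zero.
  by apply: hom_free0; rewrite /= rm.
have [[i [m gm]]|g0] := classic (exists i, exists m, hfun g i m <> 0).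
  apply: iso_trans (F_iso L'fg Sfg (iso_of_bijective g_inj (simple_surj Ssim gm))).
  by exists psi, phi.
case: l0; apply: h_inj; rewrite -[l]psiK -[LHS]/(hfun (hcomp h phi) j _) -gE.
have E : heq g (hzero _ _); last by rewrite (F_ext L'fg Sfg E) F_zero.
by move=> i m; apply: NNPP => gm; apply: g0; exists i, m.
Qed.

(* Every morphism into the kernel of p from an L without maps to K vanishes;
   this holds in particular when the kernel of p is a copy of K. *)
Definition ker_bound (E R K : grmod f) (p : grhom E R) :=
  forall L (g : grhom L E), fingen L ->
    (forall j l, hfun p j (hfun g j l) = 0) ->
    (forall (r : grhom L K) j l, hfun r j l = 0) -> forall j l, hfun g j l = 0.

Definition split_epi (E R : grmod f) (p : grhom E R) :=
  exists s : grhom R E, forall j m, hfun p j (hfun s j m) = m.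

Lemma F_split (E R : grmod f) (p : grhom E R) :
  fingen E -> fingen R -> split_epi (Fm p) -> split_epi p.
Proof.
move=> Efg Rfg [s sK]; have [s' s'E] := F_full s Rfg Efg; exists s' => j m.
rewrite -[RHS]/(hfun (hid R) j m) -[LHS]/(hfun (hcomp p s') j m).
by apply: F_faithful => // i n; rewrite F_comp // s'E sK F_id.
Qed.

(** An element [v] killed by F(p) is a map from a free module on a generator of degree [j]. Its
    preimage under F starts at an object [L] with no nonzero map to [K], since the image under F of
    such a map is determined by an element of degree [j] in F(K). *)
Lemma F_ker_bound (E R K : grmod f) (p : grhom E R) j (v : car (Fo E) j) :
  fingen E -> fingen R -> fingen K -> ker_bound K p ->
  (forall m : car (Fo K) j, m = 0) -> hfun (Fm p) j v = 0 -> v = 0.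
Proof.
move=> Efg Rfg Kfg pK FK0 pv; have [g gv] := free_hom v.
have [L [Lfg [phi [psi [phiK psiK]]]]] := F_ess (free_fingen f j).
have [g' g'E] := F_full (hcomp g phi) Lfg Efg.
have g'0 : forall i l, hfun g' i l = 0.
  apply: pK => // [i l|r i l].
    rewrite -[LHS]/(hfun (hcomp p g') i l); apply: (F_eq0 Lfg Rfg) => i' n.
    rewrite F_comp // g'E -[LHS]/(hfun (hcomp (Fm p) g) i' _).
    by apply: hom_free0; rewrite /= gv.
  apply: (F_eq0 Lfg Kfg) => i' n; rewrite -[n]phiK.
  by rewrite -[LHS]/(hfun (hcomp (Fm r) psi) i' _); apply: hom_free0.
rewrite -gv -[X in hfun g j X]psiK -[LHS]/(hfun (hcomp g phi) j _) -g'E.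
have E0 : heq g' (hzero _ _); last by rewrite (F_ext Lfg Efg E0) F_zero.
by move=> i m; rewrite g'0.
Qed.

End Autoequivalence.

(** * Thin families and extensions *)

Section ThinFamilies.
Variables (k : fieldType) (f : {poly k}) (t : k).
Implicit Types (L M N : grmod f) (d : int -> bool).

Definition generates M i (e : car M i) := forall Q : forall j, car M j -> Prop,
  Defs.submod_closed Q -> Q i e -> forall j m, Q j m.

Lemma generates_hom_eq M N i (e : car M i) (h h' : grhom M N) :
  generates e -> hfun h i e = hfun h' i e -> heq h h'.
Proof. by move=> egen E; apply: egen E; apply: submod_eq. Qed.

Lemma generates_fingen M i (e : car M i) : generates e -> fingen M.
Proof.
move=> egen; exists 1%N, (fun=> i), (fun=> e) => Q QM Qe.
exact: egen QM (Qe ord0).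
Qed.

(** The support is an interval around [i], stated in the one-step form that outward induction
    uses. *)
Definition convex_at (i : int) d :=
  [/\ d i, forall j, i <= j -> d (j + 1) -> d j & forall j, j < i -> d j -> d (j + 1)].

Definition edges_vanish d := forall j, d j != d (j + 1) -> f.[t + j%:~R] = 0.

Definition inner_nonzero d := forall j, d j -> d (j + 1) -> f.[t + j%:~R] != 0.

Record thin_family i d M (e : car M i) (w : forall j, car M j) : Prop := ThinFamily {
  tf_path : is_path e w;
  tf_gen : generates e;
  tf_cen : cen_scalar t M;
  tf_neq0 : forall j, d j -> w j <> 0;
  tf_eq0 : forall j, ~~ d j -> w j = 0 }.

Lemma eigen_path_x M i (e : car M i) w j : cen_scalar t M -> is_path e w ->
  xx M j (w j) = (xcoef f i j).[t] *: w (j + 1).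
Proof.
move=> Mt ew; rewrite (path_x _ ew) (pact_eigen _ _ (Mt _ _)) //.
exact: cen_is_linear.
Qed.

Lemma eigen_path_y M i (e : car M i) w j : cen_scalar t M -> is_path e w ->
  yy M j (w (j + 1)) = (ycoef f i j).[t] *: w j.
Proof.
move=> Mt ew; rewrite (path_y _ ew) (pact_eigen _ _ (Mt _ _)) //.
exact: cen_is_linear.
Qed.

Lemma x_neq0 M j (m : car M j) :
  cen_scalar t M -> f.[t + j%:~R] != 0 -> m <> 0 -> xx M j m <> 0.
Proof.
move=> Mt f0 m0 xm; apply: m0; apply: (scalerI f0).
by rewrite -yx_eigen // xm linear0 scaler0.
Qed.

Lemma y_neq0 M j (m : car M (j + 1)) :
  cen_scalar t M -> f.[t + j%:~R] != 0 -> m <> 0 -> yy M j m <> 0.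
Proof.
move=> Mt f0 m0 ym; apply: m0; apply: (scalerI f0).
by rewrite -xy_eigen // ym linear0 scaler0.
Qed.

Lemma path_hom M N (h : grhom M N) i (e : car M i) w :
  is_path e w -> is_path (hfun h i e) (fun j => hfun h j (w j)).
Proof.
by case=> <- wx wy; split=> // j ij; [rewrite wx // hom_x | rewrite {1}wy // hom_y].
Qed.

Lemma path_uniq M i (e : car M i) w w' : is_path e w -> is_path e w' -> forall j, w j = w' j.
Proof.
case=> wi wx wy [wi' wx' wy']; apply: (int_ind_from (i := i)).
- by rewrite wi wi'.
- by move=> j ij E; rewrite wx // wx' // E.
- by move=> j ij E; rewrite wy // wy' // E.
Qed.

Section Family.
Variables (i : int) (d : int -> bool) (M : grmod f) (e : car M i).
Variable w : forall j, car M j.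
Hypothesis eM : thin_family d e w.

Lemma tf_span j (m : car M j) : exists c, m = c *: w j.
Proof.
case: eM => ew egen Mt _ _; move: j m; apply: egen.
  move=> j; split; first by exists 0; rewrite scale0r.
  split=> [a _ _ [b ->] [c ->]|].
    by exists (a * b + c); rewrite scalerA scalerDl.
  split=> [_ [c ->]|].
    by exists (c * (t + j%:~R)); rewrite linearZ /= cenE Mt -scalerDl scalerA.
  split=> _ [c ->]; rewrite linearZZ.
    by rewrite (eigen_path_x _ Mt ew) scalerA; eexists.
  by rewrite (eigen_path_y _ Mt ew) scalerA; eexists.
by exists 1; rewrite scale1r; case: ew.
Qed.

Lemma tf_vanish j (m : car M j) : ~~ d j -> m = 0.
Proof.
by move=> dj; have [c ->] := tf_span m; rewrite (tf_eq0 eM dj) scaler0.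
Qed.

Hypothesis d_inner : inner_nonzero d.
Hypothesis d_convex : convex_at i d.

(** A nonzero homogeneous element is a multiple of some translate, and since the edges inside the
    support act invertibly, it can be moved back to the generator. *)
Lemma tf_simple : simple M.
Proof.
have [di dr dl] := d_convex.
case: (eM) => -[wi wx wy] egen Mt w0 w1.
split=> [|Q QM j v v0 Qv].
  by exists i, e; rewrite -wi; apply: w0.
apply: (egen Q QM).
have {v v0 Qv} [dj Qw] : d j /\ Q j (w j).
  have [c vc] := tf_span v; case: (boolP (d j)) => [dj|/w1 wj0]; last first.
    by case: v0; rewrite vc wj0 scaler0.
  split=> //; have c0 : c != 0 by apply/eqP=> c0; case: v0; rewrite vc c0 scale0r.
  by rewrite -[w j](scalerK c0) -vc; exact: (submodZ QM).
move: j dj Qw; apply: (int_ind_from (i := i)); first by rewrite wi.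
  move=> j ij IHj dj1 Qw; have dj := dr j ij dj1; apply: IHj => //.
  have [_ [_ [_ [_ Qy]]]] := QM j; have := Qy _ Qw.
  rewrite wx // (yx_eigen (Mt _ _)) => /(submodZ QM f.[t + j%:~R]^-1).
  by rewrite scalerK // d_inner.
move=> j ij IHj dj Qw; have dj1 := dl j ij dj; apply: IHj => //.
have [_ [_ [_ [Qx _]]]] := QM j; have := Qx _ Qw.
rewrite wy // (xy_eigen (Mt _ _)) => /(submodZ QM f.[t + j%:~R]^-1).
by rewrite scalerK // d_inner.
Qed.

(** By simplicity any translate inside the support generates. This moves the base point of Z next to
    X when the two are glued. *)
Lemma tf_rebase l : convex_at l d ->
  exists w', thin_family d (w l) w'.
Proof.
move=> [dl dr dle]; have [w' ww'] := path_exists (w l).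
have Mt := tf_cen eM; exists w'; split=> //.
- move=> Q QM Ql; apply: (tf_gen eM) => //; have [_ Qsim] := tf_simple.
  by move=> *; apply: (Qsim Q QM l (w l) (tf_neq0 eM dl) Ql).
- move: ww' => [w'l w'x w'y]; apply: (int_ind_from (i := l)).
  + by rewrite w'l => _; apply: (tf_neq0 eM).
  + move=> j lj IHj dj1; have dj := dr j lj dj1; rewrite w'x //.
    by apply: x_neq0; rewrite ?d_inner //; apply: IHj.
  + move=> j lj IHj dj; have dj1 := dle j lj dj; rewrite w'y //.
    by apply: y_neq0; rewrite ?d_inner //; apply: IHj.
- by move=> j dj; apply: tf_vanish.
Qed.

End Family.

(* Nonvanishing of the translates is tested on the model [thin_mod]. *)
Lemma thin_of_pres i d M (R : forall N : grmod f, car N i -> Prop)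
    (edge : edges_vanish d) :
  convex_at i d -> cyclic_pres M R -> R _ (thin_one i edge i) ->
  (forall N v w, is_path v w -> R N v ->
     cen v = t *: v /\ forall j, ~~ d j -> w j = 0) ->
  exists e w, R M e /\ @thin_family i d M e w.
Proof.
move=> [di dr dl] [e [Re [egen euniv]]] R1 Rw.
have [w ew] := path_exists e; have [et w0] := Rw M e w ew Re.
exists e, w; split=> //; split=> // [|j dj wj0].
  move=> j m.
  (* T and the scalar [t] are endomorphisms that agree on the generator, hence everywhere. *)
  have := @generates_hom_eq _ _ _ _ (hcen M) (hlin t (hid M) (hzero M M)) egen.
  by rewrite /heq /= !addr0 => /(_ et j m); rewrite addr0.
have [h [he _]] := euniv _ _ R1.
have := path_uniq (path_hom h ew); rewrite he => /(_ _ (thin_path edge dr dl) j).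
by rewrite wj0 linear0 => /esym; apply: thin_one_neq0.
Qed.

Lemma castc_hom M N (h : grhom M N) i j (ij : i = j) (m : car M i) :
  castc ij (hfun h i m) = hfun h j (castc ij m).
Proof. by rewrite /castc; case: _ / ij. Qed.

(** * Gluing two thin modules along an edge into a nonsplit extension *)

Section Extension.
Variables (i l : int) (dR dK : int -> bool) (R K : grmod f).
Variables (eR : car R i) (wR : forall j, car R j).
Variables (eK : car K l) (wK : forall j, car K j).
Hypothesis eRR : thin_family dR eR wR.
Hypothesis eKK : thin_family dK eK wK.
Let dE j := dR j || dK j.
Hypothesis edge : edges_vanish dE.
Hypothesis E_convex : convex_at i dE.
Hypothesis R_base : dR i.
Hypothesis same_side : forall j, dK j -> dK (j + 1) -> (i <= j) = (l <= j).

(** The extension is the thin module on the union of the supports, based at the generator of [R]. By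
    [same_side], an edge inside [K] points away from both base points or towards both, so the
    constants of the extension and of [K] agree there. *)
Lemma extension_exists : exists (E : grmod f) (p : grhom E R) (e : car E i),
  [/\ fingen E, cen_scalar t E, hfun p i e = eR, ker_bound K p &
   [/\ (forall c, hfun p i (c *: e) = eR -> c = 1),
     (forall v : car E i, exists c, v = c *: e),
     (dK (i + 1) -> xx E i e <> 0) &
     (forall j (ij : i = j + 1), dK j -> yy E j (castc ij e) <> 0)]].
Proof.
have [di dr dl] := E_convex; pose E := thin_mod i edge.
have [[wi _ _] _ Rt w0 w1] := eRR.
have [p pE] : exists p : grhom E R, forall j m,
    hfun p j m = rcoef (m : 'rV_(dE j)) *: wR j.
  apply: (thin_hom (g := hid E) (V := predT)) => //.
  - by move=> j dj; apply: w1; case/norP: dj.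
  - by move=> j _ _; apply: eigen_path_x (tf_path eRR).
  - by move=> j _ _; apply: eigen_path_y (tf_path eRR).
have p1 j : hfun p j (thin_one i edge j) = wR j.
  rewrite pE rcoef_const; case: (boolP (dE j)) => dj; first by rewrite scale1r.
  by rewrite scale0r w1 //; case/norP: dj.
have ew := thin_path edge dr dl.
exists E, p, (thin_one i edge i); split.
- exact: thin_fingen.
- exact: thin_cen.
- by rewrite p1.
- move=> L g Lfg pg rK.
  (* In the remaining degrees the extension is zero or [p] is injective. *)
  have gV j m : ~~ dK j -> hfun g j m = 0.
    move=> nK; case/orP: (orbN (dR j)) => dj; last first.
      by apply: thin_vanish; rewrite /dE (negPf dj) (negPf nK).
    have := pg j m; rewrite pE => /eqP; rewrite scaler_eq0 => /orP[/eqP r0|/eqP].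
      by rewrite (thin_oneE (hfun g j m)) r0 scale0r.
    by move=> wj0; case: (w0 _ dj wj0).
  (* The map to [K] with the same coordinates as [g]; it vanishes by assumption, and so do the
     coordinates. *)
  have [r rE] : exists r : grhom L K, forall j m,
      hfun r j m = rcoef (hfun g j m : 'rV_(dE j)) *: wK j.
    apply: (thin_hom (V := dK)) => //.
    + by move=> j; apply: (tf_cen eKK).
    + by move=> j /norP[_]; apply: (tf_eq0 eKK).
    + move=> j dj _; rewrite (eigen_path_x _ (tf_cen eKK) (tf_path eKK)).
      case: (boolP (dK (j + 1))) => dj1; last by rewrite (tf_eq0 eKK dj1) !scaler0.
      by rewrite /xcoef (same_side dj dj1).
    + move=> j dj1 _; rewrite (eigen_path_y _ (tf_cen eKK) (tf_path eKK)).
      case: (boolP (dK j)) => dj; last by rewrite (tf_eq0 eKK dj) !scaler0.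
      by rewrite /ycoef (same_side dj dj1).
  move=> j m; case/orP: (orbN (dK j)) => dj; last exact: gV.
  have := rK r j m; rewrite rE => /eqP; rewrite scaler_eq0 => /orP[/eqP r0|/eqP].
    by rewrite (thin_oneE (hfun g j m)) r0 scale0r.
  by move=> wj0; case: (tf_neq0 eKK dj wj0).
- split.
  + move=> c; rewrite linearZZ p1 wi => E1; apply/eqP; rewrite -subr_eq0.
    have : (c - 1) *: wR i = 0 by rewrite scalerBl scale1r wi E1 subrr.
    by move/eqP; rewrite scaler_eq0 => /orP[//|/eqP wi0]; case: (w0 _ R_base wi0).
  + by move=> v; eexists; apply: thin_oneE.
  + move=> dj; have [_ <- // _] := ew; apply: thin_one_neq0.
    by rewrite /dE dj orbT.
  + move=> j ij dj; rewrite (castc_section (thin_one i edge)).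
    have [_ _ <-] := ew; last by lia.
    by apply: thin_one_neq0; rewrite /dE dj orbT.
Qed.

(** A section would send [eR] to [e], but x kills [eR] and not [e]. *)
Lemma extension_right : dK (i + 1) -> xx R i eR = 0 ->
  exists (E : grmod f) (p : grhom E R) (e : car E i),
  [/\ fingen E, cen_scalar t E, hfun p i e = eR, ker_bound K p & ~ split_epi p].
Proof.
move=> dK1 xe; have [E [p [e [Efg Et pe pK [c1 span x0 _]]]]] := extension_exists.
exists E, p, e; split=> // -[s sK]; have [c sc] := span (hfun s i eR).
have c1' : c = 1 by apply: c1; rewrite -sc sK.
by apply: (x0 dK1); rewrite -[e]scale1r -c1' -sc -hom_x xe linear0.
Qed.

Lemma extension_left j (ij : i = j + 1) : dK j -> yy R j (castc ij eR) = 0 ->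
  exists (E : grmod f) (p : grhom E R) (e : car E i),
  [/\ fingen E, cen_scalar t E, hfun p i e = eR, ker_bound K p & ~ split_epi p].
Proof.
move=> dKj ye; have [E [p [e [Efg Et pe pK [c1 span _ y0]]]]] := extension_exists.
exists E, p, e; split=> // -[s sK]; have [c sc] := span (hfun s i eR).
have c1' : c = 1 by apply: c1; rewrite -sc sK.
apply: (y0 j ij dKj); rewrite -[e]scale1r -c1' -sc.
by rewrite castc_hom -hom_y ye linear0.
Qed.

End Extension.
End ThinFamilies.

(** * The simple modules of A(z(z + alpha)) *)

Section Simples.
Variables (k : fieldType) (alpha : nat).
Hypothesis hchar : [pchar k] =i pred0.
Local Notation f := (fz k alpha).
Implicit Types M N : grmod f.

Lemma intr_eq0_char0 (z : int) : (z%:~R == 0 :> k) = (z == 0).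
Proof.
case: z => n; first by rewrite -[_%:~R]/(n%:R) ((pcharf0P k).1 hchar).
by rewrite NegzE rmorphN /= oppr_eq0 -[_%:~R]/(n.+1%:R) ((pcharf0P k).1 hchar).
Qed.

Lemma intr_inj_char0 : injective (fun z : int => z%:~R : k).
Proof.
by move=> z z' /eqP; rewrite -subr_eq0 -rmorphB /= intr_eq0_char0 subr_eq0 => /eqP.
Qed.

Lemma horner_fz (t : k) (j : int) :
  f.[t + j%:~R] = (t + j%:~R) * (t + (j + alpha%:Z)%:~R).
Proof. by rewrite /fz !hornerE intrD addrA. Qed.

(** For eigenvalue -n the line of degrees is cut exactly at the edges starting in [n - alpha] and in
    [n]. The pieces are the supports of X, Z and Y from left to right; for [alpha = 0] the cuts
    coincide and the middle piece is empty. *)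
Lemma fz_root n j :
  (f.[- n%:~R + j%:~R] == 0) = (j == n) || (j == n - alpha%:Z).
Proof.
rewrite horner_fz mulf_eq0 ![- _ + _]addrC -!rmorphB /= !intr_eq0_char0; lia.
Qed.

Definition dX (n j : int) := j <= n - alpha%:Z.
Definition dY (n j : int) := n < j.
Definition dZ (n j : int) := (n - alpha%:Z < j) && (j <= n).

Lemma path_zero_right N i (v : car N i) w a : is_path v w -> i <= a -> w a = 0 ->
  forall j, a <= j -> w j = 0.
Proof.
case=> _ wx _ ia wa; apply: (int_ind_from (i := a)) => // [j aj IHj _|j ja _ aj].
  by rewrite wx ?IHj ?linear0 //; lia.
by exfalso; lia.
Qed.

Lemma path_zero_left N i (v : car N i) w a : is_path v w -> a <= i -> w a = 0 ->
  forall j, j <= a -> w j = 0.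
Proof.
case=> _ _ wy ia wa; apply: (int_ind_from (i := a)) => // [j aj _ ja|j ja IHj _].
  by exfalso; lia.
by rewrite wy ?IHj ?linear0 //; lia.
Qed.

Lemma edges_X n : edges_vanish f (- n%:~R) (dX n).
Proof. by move=> j; rewrite /dX => dj; apply/eqP; rewrite fz_root; lia. Qed.
Lemma edges_Y n : edges_vanish f (- n%:~R) (dY n).
Proof. by move=> j; rewrite /dY => dj; apply/eqP; rewrite fz_root; lia. Qed.
Lemma edges_Z n : edges_vanish f (- n%:~R) (dZ n).
Proof. by move=> j; rewrite /dZ => dj; apply/eqP; rewrite fz_root; lia. Qed.

Lemma inner_X n : inner_nonzero f (- n%:~R) (dX n).
Proof. by move=> j; rewrite /dX => dj dj1; rewrite fz_root; lia. Qed.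
Lemma inner_Y n : inner_nonzero f (- n%:~R) (dY n).
Proof. by move=> j; rewrite /dY => dj dj1; rewrite fz_root; lia. Qed.
Lemma inner_Z n : inner_nonzero f (- n%:~R) (dZ n).
Proof. by move=> j; rewrite /dZ => dj dj1; rewrite fz_root; lia. Qed.

Lemma convex_X n : convex_at (n - alpha%:Z) (dX n).
Proof. by split=> [|j|j]; rewrite /dX; lia. Qed.
Lemma convex_Y n : convex_at (n + 1) (dY n).
Proof. by split=> [|j|j]; rewrite /dY; lia. Qed.
Lemma convex_Z n l : dZ n l -> convex_at l (dZ n).
Proof. by rewrite /dZ => dl; split=> [|j|j]; lia. Qed.

(** The relation on z in each presentation only fixes the eigenvalue of T: z + alpha in degree n -
    alpha is T + n, as are z - 1 in degree n + 1 and z in degree n. *)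
Lemma cen_relX n N (v : car N (n - alpha%:Z)) :
  zz N _ v + alpha%:R *: v = 0 <-> cen v = - n%:~R *: v.
Proof.
rewrite cenE intrB scalerBl -[alpha%:Z%:~R]/(alpha%:R) addrA subrK scaleNr.
by split=> [/eqP|->]; rewrite ?addNr // addr_eq0 => /eqP.
Qed.

Lemma cen_relY n N (v : car N (n + 1)) :
  zz N _ v - v = 0 <-> cen v = - n%:~R *: v.
Proof.
rewrite cenE intrD scalerDl scale1r addrA addrK scaleNr.
by split=> [/eqP|->]; rewrite ?addNr // addr_eq0 => /eqP.
Qed.

Lemma cen_relZ n N (v : car N n) : zz N _ v = 0 <-> cen v = - n%:~R *: v.
Proof.
rewrite cenE scaleNr.
by split=> [/eqP|->]; rewrite ?addNr // addr_eq0 => /eqP.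
Qed.

Lemma cen_relM lam N (v : car N 0) : relM lam v <-> cen v = - lam *: v.
Proof.
rewrite /relM cenE scale0r addr0 scaleNr.
by split=> [/eqP|->]; rewrite ?addNr // addr_eq0 => /eqP.
Qed.

Lemma X_family n M : cyclic_pres M (@relX k alpha n) ->
  exists e w, relX e /\ thin_family (i := n - alpha%:Z) (- n%:~R) (dX n) (e : car M _) w.
Proof.
move=> MX; apply: (thin_of_pres (edge := @edges_X n)) (convex_X n) MX _ _.
  split; last by apply/cen_relX; apply: thin_cen.
  by apply: thin_vanish; rewrite /dX; lia.
move=> N v w vw [xv /cen_relX vt]; split=> // j dj.
apply: (path_zero_right (a := n - alpha%:Z + 1) vw); rewrite /dX in dj; try lia.
by case: vw => wi wx _; rewrite wx // wi.
Qed.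

Lemma Y_family n M : cyclic_pres M (@relY k alpha n) ->
  exists e w, relY e /\ thin_family (i := n + 1) (- n%:~R) (dY n) (e : car M _) w.
Proof.
move=> MY; apply: (thin_of_pres (edge := @edges_Y n)) (convex_Y n) MY _ _.
  split; last by apply/cen_relY; apply: thin_cen.
  by apply: thin_vanish; rewrite /dY; lia.
move=> N v w vw [yv /cen_relY vt]; split=> // j dj.
apply: (path_zero_left (a := n) vw); rewrite /dY in dj; try lia.
by case: vw => wi _ wy; rewrite wy ?wi //; lia.
Qed.

Lemma Z_family n M : (0 < alpha)%N -> cyclic_pres M (@relZ k alpha n) ->
  exists e w, relZ e /\ thin_family (i := n) (- n%:~R) (dZ n) (e : car M _) w.
Proof.
move=> a0 MZ; have dn : dZ n n by rewrite /dZ; lia.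
apply: (thin_of_pres (edge := @edges_Z n)) (convex_Z dn) MZ _ _.
  have [_ dr dl] := convex_Z dn.
  split; last split; last by apply/cen_relZ; apply: thin_cen.
    rewrite (ypow_path _ (thin_path _ dr dl)).
    by apply: thin_vanish; rewrite /dZ; lia.
  by apply: thin_vanish; rewrite /dZ; lia.
move=> N v w vw [yv [xv /cen_relZ vt]]; split=> // j; rewrite /dZ => dj.
have [nj|jn] := ltrP n j.
  apply: (path_zero_right (a := n + 1) vw); try lia.
  by case: vw => wi wx _; rewrite wx // wi.
apply: (path_zero_left (a := n - alpha%:Z) vw); try lia.
by rewrite -(ypow_path _ vw).
Qed.

Lemma M_family lam M : cyclic_pres M (@relM k alpha lam) ->
  exists e w, relM lam e /\ thin_family (i := 0) (- lam) predT (e : car M _) w.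
Proof.
move=> MM; have edge : edges_vanish f (- lam) predT by [].
apply: (thin_of_pres (edge := edge)) _ MM _ _ => //.
  by apply/cen_relM; apply: thin_cen.
by move=> N v w vw /cen_relM.
Qed.

Lemma inner_M lam : ~ (exists m : int, lam = m%:~R) ->
  forall j : int, f.[- lam + j%:~R] != 0.
Proof.
move=> lamZ j; rewrite horner_fz mulf_neq0 // addrC subr_eq0; apply/eqP => E;
  by apply: lamZ; eexists; rewrite -E.
Qed.

(** * Vectors satisfying the defining relations in modules with scalar T *)

Definition nonzero_at N (j : int) := exists v : car N j, v <> 0.

Lemma nonzero_at_right t N j j' : cen_scalar t N -> j <= j' ->
  (forall l, j <= l < j' -> f.[t + l%:~R] != 0) -> nonzero_at N j -> nonzero_at N j'.
Proof.
move=> Nt; move: j'; apply: (int_ind_from (i := j)) => // [j' jj' IHj _ f0|j' j'j _]; last by lia.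
move=> Nj; have [|v v0] := IHj jj' _ Nj; first by move=> l lj; apply: f0; lia.
by exists (xx N _ v); apply: x_neq0 => //; apply: f0; lia.
Qed.

Lemma nonzero_at_left t N j j' : cen_scalar t N -> j' <= j ->
  (forall l, j' <= l < j -> f.[t + l%:~R] != 0) -> nonzero_at N j -> nonzero_at N j'.
Proof.
move=> Nt; move: j'; apply: (int_ind_from (i := j)) => // [j' jj' _|j' j'j IHj _ f0]; first by lia.
move=> Nj; have [||v v0] := IHj _ _ Nj; [by lia | by move=> l lj; apply: f0; lia |].
by exists (yy N _ v); apply: y_neq0 => //; apply: f0; lia.
Qed.

Lemma nonint_socle lam N : ~ (exists m : int, lam = m%:~R) -> nonzero N ->
  cen_scalar (- lam) N -> exists2 v : car N 0, v <> 0 & relM lam v.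
Proof.
move=> lamZ [j Nj] Nt; have f0 l := inner_M lamZ l.
have [v v0] : nonzero_at N 0.
  have [j0|j0] := lerP j 0; first exact: nonzero_at_right Nt j0 _ Nj.
  exact: nonzero_at_left Nt (ltW j0) _ Nj.
by exists v => //; apply/cen_relM.
Qed.

(** A nonzero vector is moved through invertible edges to a cut. Round trips across a cut are zero,
    so either the vector is killed by the crossing or its image is killed by the way back. *)
Lemma int_socle m N : nonzero N -> cen_scalar (- m%:~R) N ->
  [\/ exists2 v : car N (m - alpha%:Z), v <> 0 & relX v,
      exists2 v : car N (m + 1), v <> 0 & relY v |
      (0 < alpha)%N /\ exists2 v : car N m, v <> 0 & relZ v].
Proof.
move=> [j Nj] Nt.
have socleX (v : car N (m - alpha%:Z)) : v <> 0 -> xx N _ v = 0 ->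
    exists2 v : car N (m - alpha%:Z), v <> 0 & relX v.
  by move=> v0 xv; exists v => //; split=> //; apply/cen_relX.
have socleY (v : car N (m + 1)) : v <> 0 -> yy N _ v = 0 ->
    exists2 v : car N (m + 1), v <> 0 & relY v.
  by move=> v0 yv; exists v => //; split=> //; apply/cen_relY.
have fm : f.[- m%:~R + m%:~R] = 0 by apply/eqP; rewrite fz_root eqxx.
have fma : f.[- m%:~R + (m - alpha%:Z)%:~R] = 0 by apply/eqP; rewrite fz_root eqxx orbT.
have am : alpha = 0%N -> m - alpha%:Z = m by move=> ->; rewrite subr0.
have middle : nonzero_at N m ->
  [\/ exists2 v : car N (m - alpha%:Z), v <> 0 & relX v,
      exists2 v : car N (m + 1), v <> 0 & relY v |
      (0 < alpha)%N /\ exists2 v : car N m, v <> 0 & relZ v].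
  move=> [v v0]; have [xv|xv] := classic (xx N m v = 0); last first.
    apply: Or32; apply: socleY xv _.
    by rewrite (yx_eigen (Nt _ _)) fm scale0r.
  have [w vw] := path_exists v.
  have [wa|wa] := classic (w (m - alpha%:Z) = 0).
    apply: Or33; split.
      rewrite lt0n; apply/eqP => /am am0; rewrite am0 in wa; apply: v0.
      by case: vw => <-.
    by exists v => //; split; [rewrite (ypow_path _ vw) | split=> //; apply/cen_relZ].
  (* For [alpha = 0] this vector is [v], already killed by x; otherwise it is an image under y
     across the lower cut, where xy is zero. *)
  apply: Or31; apply: socleX wa _; have [a0|a0] := posnP alpha.
    by rewrite (am a0); case: vw => ->.
  case: vw => _ _ ->; last by lia.
  by rewrite (xy_eigen (Nt _ _)) fma scale0r.
have [jm|mj] := lerP j m; last first.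
  have [|l lm|v v0] := nonzero_at_left (j' := m + 1) Nt _ _ Nj; first by lia.
    by rewrite fz_root; lia.
  have [yv|yv] := classic (yy N m v = 0); first by apply: Or32; apply: socleY yv.
  by apply: middle; exists (yy N m v).
have [ja|aj] := lerP j (m - alpha%:Z); last first.
  apply: middle; apply: nonzero_at_right Nt jm _ Nj => l lm.
  by rewrite fz_root; lia.
have [|v v0] := nonzero_at_right Nt ja _ Nj; first by move=> l lm; rewrite fz_root; lia.
have [a0|a0] : alpha = 0%N \/ (0 < alpha)%N by lia.
  by apply: middle; rewrite -(am a0); exists v.
have [xv|xv] := classic (xx N _ v = 0); first by apply: Or31; apply: socleX xv.
apply: middle; apply: (nonzero_at_right (j := m - alpha%:Z + 1) Nt).
- by lia.
- by move=> l lm; rewrite fz_root; lia.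
- by eexists; exact: xv.
Qed.

End Simples.

(** * Action on the simple modules *)

Section Presentations.
Variables (k : fieldType) (f : {poly k}) (i : int).
Variable R : forall N : grmod f, car N i -> Prop.
Variable M : grmod f.
Hypothesis MR : cyclic_pres M (@R).

Lemma pres_fingen : fingen M.
Proof. by case: MR => e [_ [egen _]]; apply: generates_fingen egen. Qed.

Lemma pres_hom N (v : car N i) : v <> 0 -> R v ->
  exists (h : grhom M N) (m : car M i), hfun h i m <> 0.
Proof.
case: MR => e [_ [_ euniv]] v0 /euniv[h [he _]].
by exists h, e; rewrite he.
Qed.

(** A map to a simple module that is nonzero hits the generator; a preimage satisfying the relations
    defines a section by the universal property. *)
Lemma pres_split E (p : grhom E M) : simple M ->
  (exists j m, hfun p j m <> 0) ->
  (forall v, R (hfun p i v) -> R v) -> split_epi p.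
Proof.
case: MR => e [Re [egen euniv]] Msim [j [m pm]] lift.
have [v pv] := simple_surj Msim pm e.
have [s [sv _]] : exists s : grhom M E, hfun s i e = v /\ forall s', hfun s' i e = v -> heq s s'.
  by have := euniv E v; apply; apply: lift; rewrite pv.
exists s; apply: (generates_hom_eq (h := hcomp p s) (h' := hid M) egen).
by rewrite /= sv.
Qed.

End Presentations.

Section Action.
Variables (k : fieldType) (alpha : nat).
Hypothesis hchar : [pchar k] =i pred0.
Local Notation f := (fz k alpha).
Variables (X Y Z : int -> grmod f) (Mod : k -> grmod f).
Hypothesis hX : forall n : int, cyclic_pres (X n) (@relX k alpha n).
Hypothesis hY : forall n : int, cyclic_pres (Y n) (@relY k alpha n).
Hypothesis hZ : (0 < alpha)%N -> forall n : int, cyclic_pres (Z n) (@relZ k alpha n).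
Hypothesis hM : forall lam : k, cyclic_pres (Mod lam) (@relM k alpha lam).

Definition nonint (lam : k) := ~ (exists m : int, lam = m%:~R).

Lemma simple_X n : simple (X n).
Proof.
have [e [w [_ ew]]] := X_family hchar (hX n).
exact: tf_simple ew (@inner_X _ _ hchar n) (@convex_X alpha n).
Qed.

Lemma simple_Y n : simple (Y n).
Proof.
have [e [w [_ ew]]] := Y_family hchar (hY n).
exact: tf_simple ew (@inner_Y _ _ hchar n) (convex_Y n).
Qed.

Lemma simple_Z n : (0 < alpha)%N -> simple (Z n).
Proof.
move=> a0; have [e [w [_ ew]]] := Z_family hchar a0 (hZ a0 n).
by apply: (tf_simple ew (@inner_Z _ _ hchar n)); apply: convex_Z; rewrite /dZ; lia.
Qed.

Lemma simple_Mod lam : nonint lam -> simple (Mod lam).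
Proof.
move=> lamZ; have [e [w [_ ew]]] := M_family (hM lam).
by apply: (tf_simple ew) => // j _ _; apply: inner_M.
Qed.

Lemma cen_X n : cen_scalar (- n%:~R) (X n).
Proof. by have [e [w [_ []]]] := X_family hchar (hX n). Qed.

Lemma cen_Y n : cen_scalar (- n%:~R) (Y n).
Proof. by have [e [w [_ []]]] := Y_family hchar (hY n). Qed.

Lemma cen_Z n : (0 < alpha)%N -> cen_scalar (- n%:~R) (Z n).
Proof. by move=> a0; have [e [w [_ []]]] := Z_family hchar a0 (hZ a0 n). Qed.

Lemma cen_Mod lam : cen_scalar (- lam) (Mod lam).
Proof. by have [e [w [_ []]]] := M_family (hM lam). Qed.

Lemma X_vanish n j (m : car (X n) j) : n - alpha%:Z < j -> m = 0.
Proof.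
move=> nj; have [e [w [_ ew]]] := X_family hchar (hX n).
by apply: (tf_vanish ew); rewrite /dX; lia.
Qed.

Lemma Y_vanish n j (m : car (Y n) j) : j <= n -> m = 0.
Proof.
move=> nj; have [e [w [_ ew]]] := Y_family hchar (hY n).
by apply: (tf_vanish ew); rewrite /dY; lia.
Qed.

Lemma X_not_iso_Y n : ~ iso (X n) (Y n).
Proof.
move=> XY; have [e [w [_ ew]]] := Y_family hchar (hY n).
apply: (tf_neq0 ew (j := n + 1)); first by rewrite /dY; lia.
by apply: (iso_vanish XY) => m; apply: X_vanish; lia.
Qed.

Lemma X_not_iso_Z n : (0 < alpha)%N -> ~ iso (X n) (Z n).
Proof.
move=> a0 XZ; have [e [w [_ ew]]] := Z_family hchar a0 (hZ a0 n).
apply: (tf_neq0 ew (j := n)); first by rewrite /dZ; lia.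
by apply: (iso_vanish XZ) => m; apply: X_vanish; lia.
Qed.

Lemma Y_not_iso_Z n : (0 < alpha)%N -> ~ iso (Y n) (Z n).
Proof.
move=> a0 YZ; have [e [w [_ ew]]] := Z_family hchar a0 (hZ a0 n).
apply: (tf_neq0 ew (j := n)); first by rewrite /dZ; lia.
by apply: (iso_vanish YZ) => m; apply: Y_vanish.
Qed.

Lemma extension_X_by_Z n : (0 < alpha)%N ->
  exists (E : grmod f) (p : grhom E (X n)),
  [/\ fingen E, cen_scalar (- n%:~R) E, exists j m, hfun p j m <> 0,
      ker_bound (Z n) p & ~ split_epi p].
Proof.
move=> a0; have [eX [wX [[xe _] eXX]]] := X_family hchar (hX n).
have [eZ [wZ [_ eZZ]]] := Z_family hchar a0 (hZ a0 n).
have dn : dZ alpha n (n - alpha%:Z + 1) by rewrite /dZ; lia.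
have dnn : dZ alpha n n by rewrite /dZ; lia.
(* From its own generator in degree [n] the inner edges of Z would point against the outward
   direction seen from X, so the base moves to the leftmost degree of Z. *)
have [wZ' eZZ'] := tf_rebase eZZ (@inner_Z _ _ hchar n) (convex_Z dnn) (convex_Z dn).
have edge : edges_vanish f (- n%:~R) (fun j => dX alpha n j || dZ alpha n j).
  by move=> j; rewrite /dX /dZ => dj; apply/eqP; rewrite (fz_root _ hchar); lia.
have [|||E [p [e [Efg Et pe pZ ps]]]] := extension_right eXX eZZ' edge _ _ _ dn xe.
- by split=> [|j|j]; rewrite /dX /dZ; lia.
- by rewrite /dX; lia.
- by move=> j; rewrite /dZ; lia.
exists E, p; split=> //; exists (n - alpha%:Z), e; rewrite pe.
by case: eXX => -[<- _ _] _ _ w0 _; apply: w0; rewrite /dX; lia.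
Qed.

Lemma extension_Y_by_Z n : (0 < alpha)%N ->
  exists (E : grmod f) (p : grhom E (Y n)),
  [/\ fingen E, cen_scalar (- n%:~R) E, exists j m, hfun p j m <> 0,
      ker_bound (Z n) p & ~ split_epi p].
Proof.
move=> a0; have [eY [wY [[ye _] eYY]]] := Y_family hchar (hY n).
have [eZ [wZ [_ eZZ]]] := Z_family hchar a0 (hZ a0 n).
have dn : dZ alpha n n by rewrite /dZ; lia.
have edge : edges_vanish f (- n%:~R) (fun j => dY n j || dZ alpha n j).
  by move=> j; rewrite /dY /dZ => dj; apply/eqP; rewrite (fz_root _ hchar); lia.
have [|||E [p [e [Efg Et pe pZ ps]]]] := extension_left eYY eZZ edge _ _ _ (ij := erefl) dn ye.
- by split=> [|j|j]; rewrite /dY /dZ; lia.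
- by rewrite /dY; lia.
- by move=> j; rewrite /dZ; lia.
exists E, p; split=> //; exists (n + 1), e; rewrite pe.
by case: eYY => -[<- _ _] _ _ w0 _; apply: w0; rewrite /dY; lia.
Qed.

Variables (Fo : grmod f -> grmod f) (Fm : forall M N, grhom M N -> grhom (Fo M) (Fo N)).
Arguments Fm {M N}.
Hypothesis hF : autoequiv (@Fm).

Lemma F_iso_trans S T U : fingen S -> fingen T ->
  iso U (Fo S) -> iso U (Fo T) -> iso S T.
Proof.
move=> Sfg Tfg US UT; apply: (F_iso_inv hF Sfg Tfg).
exact: iso_trans (iso_sym US) UT.
Qed.

Lemma F_simple_pres S T i (R : forall N : grmod f, car N i -> Prop) (v : car (Fo S) i) :
  fingen S -> simple S -> cyclic_pres T R -> simple T -> v <> 0 -> R _ v ->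
  iso T (Fo S).
Proof.
move=> Sfg Ssim TR Tsim v0 Rv; have [h [m hm]] := pres_hom TR v0 Rv.
by apply: (F_simple_iso hF (h := h) Sfg Ssim (pres_fingen TR) Tsim.1); apply: simple_inj hm.
Qed.

Lemma F_neq0 M N (h : grhom M N) : fingen M -> fingen N ->
  (exists j m, hfun h j m <> 0) -> exists j n, hfun (Fm h) j n <> 0.
Proof.
move=> Mfg Nfg [j [m hm]]; apply: NNPP => Fh0; apply: hm.
apply: (F_eq0 hF Mfg Nfg) => i n; apply: NNPP => hn; apply: Fh0; by exists i, n.
Qed.

(** * The affine map on eigenvalues and the images of the simple modules *)

Section Eigenvalue.
Variables u w : k.
Hypothesis F_cen : forall M, fingen M -> forall j (n : car (Fo M) j),
  cen n = u *: hfun (Fm (hcen M)) j n + w *: n.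

Lemma F_simple_int S s m : fingen S -> simple S -> cen_scalar s S ->
  u * s + w = - m%:~R ->
  [\/ iso (X m) (Fo S), iso (Y m) (Fo S) | (0 < alpha)%N /\ iso (Z m) (Fo S)].
Proof.
move=> Sfg Ssim Ss sm; have := F_cen_scalar hF F_cen Sfg Ss; rewrite sm => FSm.
have [[v v0 Rv]|[v v0 Rv]|[a0 [v v0 Rv]]] :=
  int_socle hchar (F_nonzero hF Sfg Ssim.1) FSm.
- by apply: Or31; apply: F_simple_pres Rv => //; apply: simple_X.
- by apply: Or32; apply: F_simple_pres Rv => //; apply: simple_Y.
apply: Or33; split=> //; apply: F_simple_pres Rv => //; first exact: hZ.
exact: simple_Z.
Qed.

Lemma F_simple_nonint S s lam : fingen S -> simple S -> cen_scalar s S ->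
  u * s + w = - lam -> nonint lam -> iso (Mod lam) (Fo S).
Proof.
move=> Sfg Ssim Ss sm lamZ; have := F_cen_scalar hF F_cen Sfg Ss; rewrite sm => FSm.
have [v v0 Rv] := nonint_socle lamZ (F_nonzero hF Sfg Ssim.1) FSm.
by apply: F_simple_pres Rv => //; apply: simple_Mod.
Qed.

(** Otherwise [X n] and [Y n] would both be sent to the same [Mod lam]. *)
Lemma eigen_int (n : int) : exists m : int, u * - n%:~R + w = - m%:~R.
Proof.
apply: NNPP => nZ; pose lam := - (u * - n%:~R + w).
have lamZ : nonint lam.
  by move=> [m mE]; apply: nZ; exists m; rewrite -mE opprK.
have E : u * - n%:~R + w = - lam by rewrite opprK.
have iX := F_simple_nonint (pres_fingen (hX n)) (simple_X n) (@cen_X n) E lamZ.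
have iY := F_simple_nonint (pres_fingen (hY n)) (simple_Y n) (@cen_Y n) E lamZ.
apply: (@X_not_iso_Y n); apply: F_iso_trans iX iY; first exact: pres_fingen (hX n).
exact: pres_fingen (hY n).
Qed.

(** Otherwise every simple [T] with eigenvalue -m has a preimage with eigenvalue -lam, which
    receives a nonzero map from [Mod lam]. Then F([Mod lam]), itself one of the simple modules, maps
    nontrivially to [T], so [X m] and [Y m] would be isomorphic. *)
Lemma nonint_eigen lam m : u != 0 -> nonint lam -> u * - lam + w <> - m%:~R.
Proof.
move=> u0 lamZ E; have Lfg := pres_fingen (hM lam); have Lsim := simple_Mod lamZ.
have target T : fingen T -> simple T -> cen_scalar (- m%:~R) T -> iso T (Fo (Mod lam)).
  move=> Tfg Tsim Tm; have [N [Nfg FNT]] := F_ess hF Tfg.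
  have FNm : cen_scalar (u * - lam + w) (Fo N).
    by rewrite E; apply: iso_cen_scalar (iso_sym FNT) Tm.
  have Nlam := F_cen_scalar_inv hF u0 F_cen Nfg FNm.
  have N0 : nonzero N.
    have [j [n n0]] := iso_nonzero (iso_sym FNT) Tsim.1.
    apply: NNPP => Nz; apply: n0; rewrite -(F_id hF Nfg n).
    have E0 : heq (hid N) (hzero N N); last by rewrite (F_ext hF Nfg Nfg E0) (F_zero hF).
    by move=> i n'; apply: NNPP => n0; apply: Nz; exists i, n'.
  have [v v0 Rv] := nonint_socle lamZ N0 Nlam.
  have [h [e he]] := pres_hom (hM lam) v0 Rv.
  have [|j [l hl]] := F_neq0 (h := h) Lfg Nfg; first by exists 0, e.
  have [phi phi_inj _] := iso_inj FNT.
  have aux R : simple R -> iso R (Fo (Mod lam)) -> iso T (Fo (Mod lam)).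
    move=> Rsim RL; apply: (iso_trans _ RL); apply: iso_sym.
    have [psi _ psi_surj] := iso_inj RL; have [r rl] := psi_surj j l.
    apply: (simple_schur (h := hcomp phi (hcomp (Fm h) psi)) (m := r) Rsim Tsim).
    by rewrite /= rl => /phi_inj.
  have [|| [a0]] := F_simple_int Lfg Lsim (@cen_Mod lam) E.
  - exact: aux (simple_X m).
  - exact: aux (simple_Y m).
  - exact: aux (simple_Z m a0).
have iX := target _ (pres_fingen (hX m)) (simple_X m) (@cen_X m).
have iY := target _ (pres_fingen (hY m)) (simple_Y m) (@cen_Y m).
exact: (@X_not_iso_Y m) (iso_trans iX (iso_sym iY)).
Qed.

Lemma eigen_affine : u != 0 ->
  exists a b : int, (a = 1 \/ a = -1) /\ u = a%:~R /\ w = - b%:~R.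
Proof.
move=> u0; have [b bE] := eigen_int 0; have [m mE] := eigen_int 1.
rewrite oppr0 mulr0 add0r in bE; rewrite mulrN1 bE in mE.
exists (m - b), b; have uE : u = (m - b)%:~R.
  by rewrite rmorphB /=; apply: oppr_inj; rewrite opprB addrC -mE subrK.
do 2?split=> //; have [c cE] : exists c : int, u^-1 = c%:~R.
  (* If the inverse of [u] were not an integer, [Mod] at this inverse would be sent to the integer
     eigenvalue -(1 + b). So [u] is a unit of the integers. *)
  apply: NNPP => ucZ; apply: (@nonint_eigen u^-1 (1 + b)) => //.
  by rewrite mulrN divff // bE intrD opprD.
have : (m - b) * c = 1.
  by apply: (intr_inj_char0 hchar); rewrite rmorphM /= -uE -cE divff.
move=> /(congr1 absz); rewrite abszM => /eqP.
by rewrite muln_eq1 => /andP[/eqP mb _]; lia.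
Qed.

(** F(p), followed by the isomorphism to [T], splits as soon as the relations of [T] lift along it,
    and F reflects splittings. *)
Lemma F_split_pres n m (i : int) (R : forall N : grmod f, car N i -> Prop) (T S E : grmod f)
    (p : grhom E S) :
  cyclic_pres T R -> simple T -> fingen S -> iso T (Fo S) -> fingen E ->
  cen_scalar (- n%:~R) E -> u * - n%:~R + w = - m%:~R ->
  (exists j m, hfun p j m <> 0) ->
  (forall (q : grhom (Fo E) T) v, cen_scalar (- m%:~R) (Fo E) ->
     (forall j x, hfun q j x = 0 -> hfun (Fm p) j x = 0) ->
     R T (hfun q i v) -> R (Fo E) v) ->
  split_epi p.
Proof.
move=> TR Tsim Sfg [psi [psi' [psiK psi'K]]] Efg Et nm p0 lift.
have [j [x px]] := F_neq0 Efg Sfg p0.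
have psi'0 i' y : hfun psi' i' y = 0 -> y = 0 by move=> y0; rewrite -[y]psi'K y0 linear0.
have FEt := F_cen_scalar hF F_cen Efg Et; rewrite nm in FEt.
have [||s sK] := @pres_split _ _ _ _ _ TR _ (hcomp psi' (Fm p)) Tsim.
- by exists j, x => /psi'0.
- by move=> v; apply: lift => // i' y; apply: psi'0.
apply: (F_split hF Efg Sfg); exists (hcomp s psi') => i' y.
by have := sK i' (hfun psi' i' y) => /= /(congr1 (hfun psi i')); rewrite !psi'K.
Qed.

(** If F([Z n]) were [X m] or [Y m], then F([X n]) or F([Y n]) would be the other one of the two.
    The nonsplit extension by [Z n] would become an extension between [X m] and [Y m], which splits
    because their supports are not adjacent. *)
Lemma F_Z n m : (0 < alpha)%N -> u * - n%:~R + w = - m%:~R -> iso (Z m) (Fo (Z n)).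
Proof.
move=> a0 nm; have Zfg := pres_fingen (hZ a0 n).
have Xfg := pres_fingen (hX n); have Yfg := pres_fingen (hY n).
have bad (S : grmod f) : fingen S -> (exists (E : grmod f) (p : grhom E S),
  [/\ fingen E, cen_scalar (- n%:~R) E, exists j m, hfun p j m <> 0,
      ker_bound (Z n) p & ~ split_epi p]) ->
  (iso (X m) (Fo S) -> iso (Y m) (Fo (Z n)) -> False) /\
  (iso (Y m) (Fo S) -> iso (X m) (Fo (Z n)) -> False).
  move=> Sfg [E [p [Efg Et p0 pZ ps]]]; split=> iS iZ; apply: ps.
    apply: (F_split_pres (hX m) (simple_X m) Sfg iS Efg Et nm p0).
    move=> q v FEm qp [xv _]; split; last by apply/cen_relX; apply: FEm.
    (* The image of [v] under x has degree [m - alpha + 1], at most [m] since [alpha] is positive,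
       where [Y m] is zero. *)
    apply: (F_ker_bound hF Efg Sfg Zfg pZ); last by apply: qp; rewrite hom_x.
    by apply: (iso_vanish iZ) => y; apply: Y_vanish; lia.
  apply: (F_split_pres (hY m) (simple_Y m) Sfg iS Efg Et nm p0).
  move=> q v FEm qp [yv _]; split; last by apply/cen_relY; apply: FEm.
  (* The image of [v] under y has degree [m], where [X m] is zero. *)
  apply: (F_ker_bound hF Efg Sfg Zfg pZ); last by apply: qp; rewrite hom_y.
  by apply: (iso_vanish iZ) => y; apply: X_vanish; lia.
have [badX1 badX2] := bad _ Xfg (extension_X_by_Z n a0).
have [badY1 badY2] := bad _ Yfg (extension_Y_by_Z n a0).
have cX := F_simple_int Xfg (simple_X n) (@cen_X n) nm.
have cY := F_simple_int Yfg (simple_Y n) (@cen_Y n) nm.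
have nXY U : iso U (Fo (X n)) -> iso U (Fo (Y n)) -> False.
  by move=> UX UY; apply: (@X_not_iso_Y n); apply: F_iso_trans UX UY.
have nXZ U : iso U (Fo (X n)) -> iso U (Fo (Z n)) -> False.
  by move=> UX UZ; apply: (@X_not_iso_Z n a0); apply: F_iso_trans UX UZ.
have nYZ U : iso U (Fo (Y n)) -> iso U (Fo (Z n)) -> False.
  by move=> UY UZ; apply: (@Y_not_iso_Z n a0); apply: F_iso_trans UY UZ.
have [ZX|ZY|[_ //]] := F_simple_int Zfg (simple_Z n a0) (@cen_Z n a0) nm; exfalso.
  case: cX => [XX|XY|[_ XZ]]; [exact: nXZ XX ZX | exact: badX2 XY ZX |].
  case: cY => [YX|YY|[_ YZ]]; [exact: nYZ YX ZX | exact: badY2 YY ZX |].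
  exact: nXY XZ YZ.
case: cX => [XX|XY|[_ XZ]]; [exact: badX1 XX ZY | exact: nXZ XY ZY |].
case: cY => [YX|YY|[_ YZ]]; [exact: badY1 YX ZY | exact: nYZ YY ZY |].
exact: nXY XZ YZ.
Qed.

(** When [alpha] is positive the value [Z m] is already taken by [Z n], which leaves [X m] and [Y m]
    for the other two. *)
Lemma F_XY n m : u * - n%:~R + w = - m%:~R ->
  iso (Fo (X n)) (X m) /\ iso (Fo (Y n)) (Y m) \/
  iso (Fo (X n)) (Y m) /\ iso (Fo (Y n)) (X m).
Proof.
move=> nm; have Xfg := pres_fingen (hX n); have Yfg := pres_fingen (hY n).
have nXY U : iso U (Fo (X n)) -> iso U (Fo (Y n)) -> False.
  by move=> UX UY; apply: (@X_not_iso_Y n); apply: F_iso_trans UX UY.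
have nXZ : (0 < alpha)%N -> iso (Z m) (Fo (X n)) -> False.
  move=> a0 UX; apply: (@X_not_iso_Z n a0); apply: F_iso_trans UX (F_Z a0 nm) => //.
  exact: pres_fingen (hZ a0 n).
have nYZ : (0 < alpha)%N -> iso (Z m) (Fo (Y n)) -> False.
  move=> a0 UY; apply: (@Y_not_iso_Z n a0); apply: F_iso_trans UY (F_Z a0 nm) => //.
  exact: pres_fingen (hZ a0 n).
have [XX|XY|[a0 /(nXZ a0)//]] := F_simple_int Xfg (simple_X n) (@cen_X n) nm;
have [YX|YY|[a0 /(nYZ a0)//]] := F_simple_int Yfg (simple_Y n) (@cen_Y n) nm.
- by case: (nXY _ XX YX).
- by left; split; apply: iso_sym.
- by right; split; apply: iso_sym.
- by case: (nXY _ XY YY).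
Qed.

End Eigenvalue.
End Action.

(** * Existence and uniqueness of the integers a and b *)

Theorem theorem5p3 (k : closedFieldType) (hchar : [pchar k] =i pred0)
  (alpha : nat)
  (X Y Z : int -> grmod (fz k alpha)) (Mod : k -> grmod (fz k alpha))
  (hX : forall n : int, cyclic_pres (X n) (@relX k alpha n))
  (hY : forall n : int, cyclic_pres (Y n) (@relY k alpha n))
  (hZ : (0 < alpha)%N -> forall n : int, cyclic_pres (Z n) (@relZ k alpha n))
  (hM : forall lam : k, cyclic_pres (Mod lam) (@relM k alpha lam))
  (Fo : grmod (fz k alpha) -> grmod (fz k alpha))
  (Fm : forall M N, grhom M N -> grhom (Fo M) (Fo N))
  (hF : autoequiv Fm) :
  exists! ab : int * int,
    (ab.1 = 1 \/ ab.1 = -1) /\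
    (forall n : int,
       (iso (Fo (X n)) (X (ab.1 * n + ab.2)) /\ iso (Fo (Y n)) (Y (ab.1 * n + ab.2))) \/
       (iso (Fo (X n)) (Y (ab.1 * n + ab.2)) /\ iso (Fo (Y n)) (X (ab.1 * n + ab.2)))) /\
    (forall lam : k, ~ (exists m : int, lam = m%:~R) ->
       iso (Fo (Mod lam)) (Mod (ab.1%:~R * lam + ab.2%:~R))) /\
    ((0 < alpha)%N -> forall n : int, iso (Fo (Z n)) (Z (ab.1 * n + ab.2))).
Proof.
have [u [w [u0 F_cen]]] := F_cen_affine hF.
have [a [b [a1 [uE wE]]]] := eigen_affine hchar hX hY hZ hM hF F_cen u0.
have nm n : u * - n%:~R + w = - (a * n + b)%:~R.
  by rewrite uE wE intrD rmorphM /= mulrN opprD.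
exists (a, b); split.
  split=> //; split=> [n /=|].
    exact: (F_XY hchar hX hY hZ hF F_cen (nm n)).
  split=> [lam lamZ|a0 n]; last first.
    exact: iso_sym (F_Z hchar hX hY hZ hF F_cen a0 (nm n)).
  apply: iso_sym; apply: (F_simple_nonint hM hF F_cen (pres_fingen (hM lam))
    (simple_Mod hM lamZ) (cen_Mod hM (lam := lam))).
    by rewrite uE wE mulrN opprD.
  (* Since a a = 1, the equation a lam + b = m gives lam = a (m - b). *)
  move=> [m mE]; apply: lamZ; exists (a * (m - b)).
  rewrite rmorphM rmorphB /= -mE addrK mulrA -rmorphM /=.
  by rewrite (_ : a * a = 1) ?mul1r //; case: a1 => ->.
move=> [a' b'] /= [a1' [XY' _]].
(* F([X n]) has a single T-eigenvalue, whichever of X and Y it is isomorphic to; the values at 0 and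
   1 then fix both integers. *)
have mE n : a * n + b = a' * n + b'.
  apply: (intr_inj_char0 hchar); apply: oppr_inj; rewrite -nm.
  have Xfg := pres_fingen (hX n); have Xn := simple_X hchar hX n.
  have Ft := F_cen_scalar hF F_cen Xfg (cen_X hchar hX (n := n)).
  have Fn0 := F_nonzero hF Xfg Xn.1.
  apply: (cen_scalar_inj Fn0 Ft).
  have [[iX _]|[iY _]] := XY' n.
    exact: iso_cen_scalar (iso_sym iX) (cen_X hchar hX (n := _)).
  exact: iso_cen_scalar (iso_sym iY) (cen_Y hchar hY (n := _)).
have bE : b = b' by have := mE 0; rewrite !mulr0 !add0r.
by congr (_, _) => //; have := mE 1; rewrite !mulr1 bE => /addIr.
Qed.
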